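(* Consider the system $$du(t)=f(t,r(t),u(t),u(t-\rho_0(t)))\,dt+g(t,r(t),u(t),u(t-\rho_0(t)))\,dW(t),\quad t>s,$$ $$u(s+\tau)=\xi(\tau),\ -\rho\le\tau\le 0,\qquad r(s)=j,$$ under the standing assumptions $(A_0)$ and $(A_1)$ given in the context. Fix $(\xi,j)\in H$, and for each $t\in\mathbb{R}$ and each $n\in\mathbb{N}$ with $n>\rho-t$ let $\mu_{n,t}$ be the probability measure on $H$ defined by $$\mu_{n,t}(\cdot)=\frac{1}{t-\rho+n}\int_{-n}^{t-\rho}P(t,\tau,\xi,j,\cdot)\,d\tau .$$ Let $\varpi>0$. Suppose that for each $t\in\mathbb{R}$ the sequence $\{\mu_{n,t}\}_{n}$ is tight on $H$, and that the Markov processes $y(t,s,\cdot,\cdot)$ are $\varpi$-periodic. Then the system has a $\varpi$-periodic evolution system of measures, i.e. there is a family $(\mu_t)_{t\in\mathbb{R}}$ of probability measures on $H$ such that $\int_H P_{s,t}\varphi\,d\mu_s=\int_H\varphi\,d\mu_t$ for all $s<t$ and all $\varphi\in C_b(H)$, and $\mu_{t+\varpi}=\mu_t$ for all $t\in\mathbb{R}$.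
   Context: Setting. $0<\rho\le 1$; $C_\rho=C([-\rho,0],\mathbb{R}^n)$ with $\|\phi\|_\rho=\sup_{-\rho\le\tau\le0}|\phi(\tau)|$. $W$ is an $m$-dimensional standard two-sided Wiener process on a complete filtered probability space $(\Omega,\mathcal{F},\{\mathcal{F}_t\}_{t\in\mathbb{R}},P)$ satisfying the usual conditions. $r(t)$, $t\in\mathbb{R}$, is a right-continuous irreducible Markov chain, independent of $W$, with finite state space $S=\{1,\dots,N\}$ and generator $\Gamma=(r_{ij})_{N\times N}$, where $r_{ij}>0$ is the transition rate from $i$ to $j$ for $i\ne j$ and $r_{ii}=-\sum_{j\neq i}r_{ij}$. $\rho_0:\mathbb{R}\to[0,\rho]$ is Borel measurable, and $f:\mathbb{R}\times S\times\mathbb{R}^n\times\mathbb{R}^n\to\mathbb{R}^n$, $g:\mathbb{R}\times S\times\mathbb{R}^n\times\mathbb{R}^n\to\mathbb{R}^{n\times m}$ are Borel measurable. The initial data are $s\in\mathbb{R}$, $\xi\in C_\rho$, $j\in S$. $(A_0)$ There are positive constants $L_f,L_g$ such that for all $t\in\mathbb{R}$, $j\in S$, $x_i,y_i\in\mathbb{R}^n$ ($i=1,2$): $|f(t,j,x_1,x_2)-f(t,j,y_1,y_2)|\le L_f(|x_1-y_1|+|x_2-y_2|)$ and $|g(t,j,x_1,x_2)-g(t,j,y_1,y_2)|\le L_g(|x_1-y_1|+|x_2-y_2|)$. $(A_1)$ For every $j\in S$, $\sup_{t\in\mathbb{R}}|f(t,j,0,0)|<\infty$ and $\sup_{t\in\mathbb{R}}|g(t,j,0,0)|<\infty$.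 Under $(A_0)$ and $(A_1)$ the system has a unique solution, denoted $u(t,s,\xi,j)$; $r_{s,j}(t)$ denotes the Markov chain starting from state $j$ at time $s$. The segment is $u_t(s,\xi,j)(\tau)=u(t+\tau,s,\xi,j)$, $\tau\in[-\rho,0]$, a $C_\rho$-valued random variable. $H=C_\rho\times S$ with metric $\|\xi_1-\xi_2\|_\rho+|j_1-j_2|$; $C_b(H)$ is the space of bounded continuous real functions on $H$. The $H$-valued process $y(t,s,\xi,j)=(u_t(s,\xi,j),r_{s,j}(t))$ is a time-nonhomogeneous Markov process; $P(t,s,\xi,j,\cdot)$ denotes the law of $y(t,s,\xi,j)$ on $H$ (transition probability), and $P_{s,t}\varphi(\xi,j)=\mathbb{E}[\varphi(y(t,s,\xi,j))]$ for $\varphi\in C_b(H)$. The operators $P_{s,t}$ are Feller, i.e. $P_{s,t}:C_b(H)\to C_b(H)$ for $s<t$. The Markov processes $y$ are called $\varpi$-periodic if $P(t+\varpi,s+\varpi,\xi,j,\cdot)=P(t,s,\xi,j,\cdot)$ for all $s\le t$ and all $(\xi,j)\in H$. *)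

(* Defs.v *)
From HB Require Import structures.
From mathcomp Require Import all_boot all_order all_algebra.
From mathcomp Require Import all_classical all_reals all_analysis.
From mathcomp Require Import ring.

Set Implicit Arguments.
Unset Strict Implicit.
Unset Printing Implicit Defensive.

Import Order.TTheory GRing.Theory Num.Theory.
Import numFieldNormedType.Exports.

Local Open Scope classical_set_scope.
Local Open Scope ring_scope.

(* The library norm of a matrix is the maximum norm; [enorm] is the Euclidean
   norm on column vectors and the trace (Frobenius) norm on matrices. *)
Definition enorm {R : realType} {p q : nat} (A : 'M[R]_(p, q)) : R :=
  Num.sqrt (\sum_i \sum_j A i j ^+ 2).

Section enorm_theory.
Context {R : realType} {p q : nat}.
Implicit Types A B : 'M[R]_(p, q).

Let ssq A := \sum_i \sum_j A i j ^+ 2.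

Let ssq_ge0 A : 0 <= ssq A.
Proof.
by apply: sumr_ge0 => i _; apply: sumr_ge0 => j _; exact: sqr_ge0.
Qed.

Lemma enorm_ge0 A : 0 <= enorm A.
Proof. exact: sqrtr_ge0. Qed.

Lemma enorm0 : enorm (0 : 'M[R]_(p, q)) = 0.
Proof.
rewrite /enorm big1 ?sqrtr0// => i _; rewrite big1// => j _.
by rewrite mxE expr0n.
Qed.

Lemma enorm_eq0 A : enorm A = 0 -> A = 0.
Proof.
move=> /eqP; rewrite sqrtr_eq0 => A0; apply/matrixP => i j; rewrite mxE.
have /eqP : ssq A = 0 by apply/le_anti; rewrite ssq_ge0 A0.
rewrite psumr_eq0; last by move=> ? _; apply: sumr_ge0 => ? _; exact: sqr_ge0.
move=> /allP/(_ i (mem_index_enum _)) /=.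
rewrite psumr_eq0; last by move=> ? _; exact: sqr_ge0.
by move=> /allP/(_ j (mem_index_enum _)) /=; rewrite sqrf_eq0 => /eqP.
Qed.

Lemma enormN A : enorm (- A) = enorm A.
Proof.
congr Num.sqrt; apply: eq_bigr => i _; apply: eq_bigr => j _.
by rewrite mxE sqrrN.
Qed.

Let dot A B := \sum_i \sum_j A i j * B i j.

Let ssqZD (a b : R) A B :
  ssq (a *: A + b *: B) = a ^+ 2 * ssq A + (a * b * dot A B) *+ 2
                          + b ^+ 2 * ssq B.
Proof.
rewrite /ssq /dot !mulr_sumr -sumrMnl -!big_split; apply: eq_bigr => i _ /=.
rewrite !mulr_sumr -sumrMnl -!big_split; apply: eq_bigr => j _ /=.
rewrite !mxE sqrrD !exprMn; congr (_ + _ *+ 2 + _).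
by rewrite mulrACA.
Qed.

Let sqr_enorm A : enorm A ^+ 2 = ssq A.
Proof. exact: sqr_sqrtr (ssq_ge0 A). Qed.

Lemma enormD A B : enorm (A + B) <= enorm A + enorm B.
Proof.
have A0 := enorm_ge0 A; have B0 := enorm_ge0 B.
have [/enorm_eq0 ->|eA] := eqVneq (enorm A) 0.
  by rewrite enorm0 !add0r.
have [/enorm_eq0 ->|eB] := eqVneq (enorm B) 0.
  by rewrite enorm0 !addr0.
have AB0 : 0 < enorm A * enorm B by rewrite mulr_gt0// lt_def ?eA ?eB.
have dAB : dot A B <= enorm A * enorm B.
  have := ssq_ge0 (enorm B *: A + (- enorm A) *: B).
  rewrite ssqZD -!sqr_enorm.
  have -> : enorm B ^+ 2 * enorm A ^+ 2 + (enorm B * - enorm A * dot A B) *+ 2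
      + (- enorm A) ^+ 2 * enorm B ^+ 2
      = (enorm A * enorm B) * ((enorm A * enorm B - dot A B) *+ 2) by ring.
  by rewrite pmulr_rge0// pmulrn_lge0// subr_ge0.
rewrite -(@ler_pXn2r _ 2)// ?nnegrE ?addr_ge0 ?enorm_ge0//.
have := ssqZD 1 1 A B; rewrite !scale1r expr1n !mul1r -!sqr_enorm => ->.
by rewrite sqrrD lerD2r lerD2l lerMn2r.
Qed.

Lemma enorm_bound A : enorm A <= \sum_i \sum_j `|A i j|.
Proof.
have s0 : 0 <= \sum_i \sum_j `|A i j|.
  by apply: sumr_ge0 => i _; apply: sumr_ge0.
rewrite -(ger0_norm s0) -sqrtr_sqr ler_sqrt ?sqr_ge0// expr2.
rewrite mulr_suml; apply: ler_sum => i _; rewrite mulr_suml.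
apply: ler_sum => j _; rewrite -real_normK ?num_real// expr2.
rewrite ler_wpM2l// (bigD1 i)//= (bigD1 j)//= -addrA lerDl addr_ge0//.
  exact: sumr_ge0.
by apply: sumr_ge0 => k _; apply: sumr_ge0.
Qed.

End enorm_theory.

(* [Crho rho n] is C([-rho, 0], R^n). The library already gives
   [continuousType] the topology of pointwise convergence, so the metric of
   uniform convergence is put on this alias. *)
Definition Crho (R : realType) (rho : R) (n : nat) : Type :=
  continuousType (`[- rho, 0]%classic : set R) 'cV[R]_n.

Definition Crho_fun (R : realType) (rho : R) n (phi : Crho rho n) :
    (`[- rho, 0]%classic : set R) -> 'cV[R]_n :=
  Continuous.sort phi.
Coercion Crho_fun : Crho >-> Funclass.

HB.instance Definition _ (R : realType) (rho : R) n :=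
  Choice.copy (Crho rho n)
    (continuousType (`[- rho, 0]%classic : set R) 'cV[R]_n).

Definition mkCrho (R : realType) (rho : R) n
    (x : (`[- rho, 0]%classic : set R) -> 'cV[R]_n) (cx : continuous x) :
  Crho rho n :=
  (mkcts cx : continuousType (`[- rho, 0]%classic : set R) 'cV[R]_n).

HB.instance Definition _ (R : realType) (rho : R) n :=
  isPointed.Build (Crho rho n) (mkCrho (@cst_continuous _ _ (0 : 'cV[R]_n))).

Definition Crho_dist (R : realType) (rho : R) n (phi psi : Crho rho n) : R :=
  sup [set enorm (phi t - psi t) | t in setT].

Section Crho_metric.
Context {R : realType} {rho : R} {n : nat}.
Implicit Types phi psi : Crho rho n.

Let D phi psi := [set enorm (phi t - psi t) | t in setT].

Let coord_bounded phi (i : 'I_n) :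
  exists M : R, forall t, `|phi t i 0| <= M.
Proof.
pose h (t : `[- rho, 0]%classic) : R := phi t i 0.
have ch : continuous h.
  move=> t; apply: (@continuous_comp _ _ _ (phi : _ -> _)
    (fun M : 'cV[R]_n => M i 0)); first exact: (@cts_fun _ _ phi).
  exact: coord_continuous.
have /(continuous_compact) : {within `[- rho, 0]%classic, continuous (valL_ 0 h)}.
  exact/subspace_valL_continuousP'.
move=> /(_ (@segment_compact _ _ _)) /compact_bounded [M [_ /(_ (M + 1))]].
rewrite ltrDl ltr01 => /(_ isT) hM; exists (M + 1) => t; apply: hM.
exists (val t); first exact: set_valP.
exact: (congr1 (fun F => F h t) (sigL_valL (0 : R))).

Qed.

Let D_ub phi psi : has_ubound (D phi psi).
Proof.
have /choice[M hM] : forall i, exists M : R, forall t, `|phi t i 0| <= M.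
  exact: coord_bounded.
have /choice[M' hM'] : forall i, exists M : R, forall t, `|psi t i 0| <= M.
  exact: coord_bounded.
exists (\sum_i (M i + M' i)) => _ [t _ <-].
apply: (le_trans (enorm_bound _)); apply: ler_sum => i _.
rewrite big_ord1 !mxE; apply: (le_trans (ler_normB _ _)).
exact: lerD.
Qed.

Let D_le phi psi t : enorm (phi t - psi t) <= Crho_dist phi psi.
Proof. by apply: ub_le_sup; [exact: D_ub|exists t]. Qed.

Let le_D phi psi (e : R) : 0 <= e ->
  (forall t, enorm (phi t - psi t) <= e) -> Crho_dist phi psi <= e.
Proof.
move=> e0 he; have [D0|/set0P D0] := eqVneq (D phi psi) set0.
  by rewrite /Crho_dist -/(D phi psi) D0 sup0.
by apply: ge_sup => // _ [t _ <-]; exact: he.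
Qed.

Let D_ge0 phi psi : 0 <= Crho_dist phi psi.
Proof.
have [D0|/set0P[_ [t _ _]]] := eqVneq (D phi psi) set0.
  by rewrite /Crho_dist -/(D phi psi) D0 sup0.
exact: le_trans (enorm_ge0 _) (D_le phi psi t).
Qed.

Lemma Crho_distxx phi : Crho_dist phi phi = 0.
Proof.
apply/le_anti; rewrite D_ge0 andbT; apply: le_D => // t.
by rewrite subrr enorm0.
Qed.

Lemma Crho_dist_eq0 phi psi : Crho_dist phi psi = 0 -> phi = psi.
Proof.
move=> d0; apply/continuousEP => t; apply/eqP; rewrite -subr_eq0; apply/eqP.
apply: enorm_eq0; apply/le_anti; rewrite enorm_ge0 andbT.
by apply: le_trans (D_le phi psi t) _; rewrite d0.
Qed.

Lemma Crho_dist_sym phi psi : Crho_dist phi psi = Crho_dist psi phi.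
Proof.
by apply/le_anti; rewrite !le_D// => t; rewrite -enormN opprB D_le.
Qed.

Lemma Crho_dist_triangle psi phi chi :
  Crho_dist phi chi <= Crho_dist phi psi + Crho_dist psi chi.
Proof.
apply: le_D => [|t]; first exact: addr_ge0.
rewrite -(subrK (psi t) (phi t)) -addrA (le_trans (enormD _ _))//.
by rewrite lerD.
Qed.

End Crho_metric.

HB.instance Definition _ (R : realType) (rho : R) n :=
  isMetric.Build R (Crho rho n) (@Crho_distxx R rho n) (@Crho_dist_eq0 R rho n)
    (@Crho_dist_sym R rho n) (@Crho_dist_triangle R rho n).

(* [Hsp rho n N] is the product of C([-rho, 0], R^n) with the state space S of
   the chain. S = {1, ..., N + 1} is represented by ['I_N.+1]: it is nonempty,
   and the shift of the labels does not change |j1 - j2|. *)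
Definition Hsp (R : realType) (rho : R) (n N : nat) : Type :=
  (Crho rho n * 'I_N.+1)%type.

HB.instance Definition _ (R : realType) (rho : R) n N :=
  Choice.copy (Hsp rho n N) (Crho rho n * 'I_N.+1)%type.

HB.instance Definition _ (R : realType) (rho : R) n N :=
  isPointed.Build (Hsp rho n N) (point, ord0).

Definition Hsp_dist (R : realType) (rho : R) n N (y z : Hsp rho n N) : R :=
  mdist y.1 z.1 + `|y.2%:R - z.2%:R|.

Section Hsp_metric.
Context {R : realType} {rho : R} {n N : nat}.
Implicit Types x y z : Hsp rho n N.

Lemma Hsp_distxx y : Hsp_dist y y = 0.
Proof. by rewrite /Hsp_dist mdistxx subrr normr0 addr0. Qed.

Lemma Hsp_dist_eq0 y z : Hsp_dist y z = 0 -> y = z.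
Proof.
case: y z => [y i] [z j] /eqP; rewrite paddr_eq0 ?mdist_ge0//=.
move=> /andP[/eqP/mdist_positivity ->].
by rewrite normr_eq0 subr_eq0 eqr_nat => /eqP/val_inj ->.
Qed.

Lemma Hsp_dist_sym y z : Hsp_dist y z = Hsp_dist z y.
Proof. by rewrite /Hsp_dist metric_sym distrC. Qed.

Lemma Hsp_dist_triangle y x z : Hsp_dist x z <= Hsp_dist x y + Hsp_dist y z.
Proof.
by rewrite /Hsp_dist addrACA lerD ?metric_triangle ?ler_distD.
Qed.

End Hsp_metric.

HB.instance Definition _ (R : realType) (rho : R) n N :=
  isMetric.Build R (Hsp rho n N) (@Hsp_distxx R rho n N)
    (@Hsp_dist_eq0 R rho n N) (@Hsp_dist_sym R rho n N)
    (@Hsp_dist_triangle R rho n N).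

Notation HspB rho n N := (g_sigma_algebraType (@open (Hsp rho n N))).

Definition Cb (T : topologicalType) (R : realType) (phi : T -> R) : Prop :=
  continuous phi /\ exists M : R, forall x, `|phi x| <= M.

(* When [G] is a sigma-algebra: measurability from [G] to the Borel sets. *)
Definition meas_wrt (T : Type) (G : set (set T)) (U : topologicalType)
    (X : T -> U) : Prop :=
  forall B, open B -> G (X @^-1` B).

Definition borel_fun (T U : topologicalType) (h : T -> U) : Prop :=
  meas_wrt <<s @open T >> h.

(* The sigma-algebra generated by the random variables [X t], [t \in I], where
   [C] generates the sigma-algebra of the state space. *)
Definition sigma_proc (R : realType) (Omega T : Type) (I : set R)
    (C : set (set T)) (X : R -> Omega -> T) : set (set Omega) :=
  <<s [set A | exists2 t, I t & exists2 B, C B & A = X t @^-1` B] >>.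

Section stochastic_basis.
Context {d : measure_display} {Omega : measurableType d} {R : realType}.
Variables (P : probability Omega R) (F : R -> set (set Omega)).

Definition usual_conditions : Prop :=
  [/\ measure_is_complete P,
      forall t, sigma_algebra setT (F t) /\ F t `<=` measurable,
      forall s t, s <= t -> F s `<=` F t,
      forall t, \bigcap_(v in `]t, +oo[) F v `<=` F t &
      forall t, P.-negligible `<=` F t].

(* Two-sided: only increments are adapted. Since [W 0 = 0], adaptedness of
   [W t] itself for t < 0 would contradict the independence of increments. *)
Definition is_wiener (m : nat) (W : R -> Omega -> 'cV[R]_m) : Prop :=
  [/\ {ae P, forall w, W 0 w = 0},
      forall w, continuous (W ^~ w),
      forall s t, s <= t -> meas_wrt (F t) (fun w => W t w - W s w) &
      forall s t, s < t -> forall A, F s A ->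
        forall B : 'I_m -> set R, (forall i, measurable (B i)) ->
        P (A `&` [set w | forall i, B i ((W t w - W s w) i 0)]) =
        (P A * \prod_(i < m) normal_prob 0 (Num.sqrt (t - s)) (B i))%E].

Section markov_chain.
Context {N : nat}.

Definition is_generator (Gam : 'M[R]_N.+1) : Prop :=
  [/\ forall i k, i != k -> 0 < Gam i k,
      forall i, Gam i i = - \sum_(k | k != i) Gam i k &
      forall i k, connect [rel a b | 0 < Gam a b] i k].

Definition transition_semigroup (Gam : 'M[R]_N.+1) (p : R -> 'M[R]_N.+1) : Prop :=
  [/\ forall h, 0 <= h -> forall i k, 0 <= p h i k,
      forall h, 0 <= h -> forall i, \sum_k p h i k = 1,
      p 0 = 1%:M,
      forall a b, 0 <= a -> 0 <= b -> p (a + b) = p a *m p b &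
      (fun h => h^-1 *: (p h - 1%:M)) @ 0^'+ --> Gam].

(* [r] is the chain r_{s,j}, defined for times t >= s. *)
Definition is_markov_chain (m : nat) (W : R -> Omega -> 'cV[R]_m)
    (Gam : 'M[R]_N.+1) (s : R) (j : 'I_N.+1) (r : R -> Omega -> 'I_N.+1) : Prop :=
  [/\ forall w, r s w = j,
      forall w t, s <= t -> \forall v \near t^'+, r v w = r t w,
      forall t, s <= t -> forall i, F t (r t @^-1` [set i]),
      exists2 p, transition_semigroup Gam p &
        forall u v, s <= u -> u <= v ->
        forall A, sigma_proc `[s, u]%classic setT r A -> forall i k,
        P (A `&` r u @^-1` [set i] `&` r v @^-1` [set k]) =
        (P (A `&` r u @^-1` [set i]) * (p (v - u) i k)%:E)%E &
      forall A B, sigma_proc `[s, +oo[%classic setT r A ->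
        sigma_proc setT open W B -> P (A `&` B) = (P A * P B)%E].

End markov_chain.

Section ito_integral.
Context {n m : nat} (W : R -> Omega -> 'cV[R]_m).

Record simple_process (s t : R) := SimpleProcess {
  sp_size : nat ;
  sp_pt : nat -> R ;
  sp_val : nat -> Omega -> 'M[R]_(n, m) ;
  sp_start : sp_pt 0 = s ;
  sp_end : sp_pt sp_size = t ;
  sp_le : forall i, (i < sp_size)%N -> sp_pt i <= sp_pt i.+1 ;
  sp_meas : forall i, (i < sp_size)%N -> meas_wrt (F (sp_pt i)) (sp_val i) ;
  sp_bounded : exists M : R, forall i w, (i < sp_size)%N ->
    enorm (sp_val i w) <= M }.

Definition sp_fun s t (Z : simple_process s t) (v : R) (w : Omega) : 'M[R]_(n, m) :=
  \sum_(i < sp_size Z)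
    (\1_(`[sp_pt Z i, sp_pt Z i.+1[%classic) v : R) *: sp_val Z i w.

Definition sp_integral s t (Z : simple_process s t) (w : Omega) : 'cV[R]_n :=
  \sum_(i < sp_size Z) sp_val Z i w *m (W (sp_pt Z i.+1) w - W (sp_pt Z i) w).

Definition sq_dist s t (G K : R -> Omega -> 'M[R]_(n, m)) (w : Omega) : \bar R :=
  \int[lebesgue_measure]_(v in `[s, t]) ((enorm (G v w - K v w) ^+ 2)%:E).

Definition ito_integrand (s t : R) (G : R -> Omega -> 'M[R]_(n, m)) : Prop :=
  [/\ forall v, s <= v <= t -> meas_wrt (F v) (G v),
      forall i k, measurable_fun (`[s, t]%classic `*` [set: Omega])
        (fun z : R * Omega => G z.1 z.2 i k) &
      {ae P, forall w, (sq_dist s t G (fun _ _ => 0%R) w < +oo)%E}].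

(* [X] is a version of the Ito integral of [G] over [s, t]: the limit in
   probability of the integrals of simple processes that approximate [G] in
   L^2([s, t]), in probability. *)
Definition is_ito_integral (s t : R) (G : R -> Omega -> 'M[R]_(n, m))
    (X : Omega -> 'cV[R]_n) : Prop :=
  [/\ ito_integrand s t G, meas_wrt (F t) X &
      exists Z : nat -> simple_process s t, forall e : R, 0 < e ->
        P [set w | (e%:E <= sq_dist s t (sp_fun (Z k)) G w)%E]
          @[k --> \oo] --> 0%E /\
        P [set w | e <= enorm (sp_integral (Z k) w - X w)]
          @[k --> \oo] --> 0%E].

End ito_integral.

Section switching_sde.
Context {n m N : nat} {rho : R}.
Variables (W : R -> Omega -> 'cV[R]_m) (rho0 : R -> R).
Variables (f : R -> 'I_N.+1 -> 'cV[R]_n -> 'cV[R]_n -> 'cV[R]_n).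
Variables (g : R -> 'I_N.+1 -> 'cV[R]_n -> 'cV[R]_n -> 'M[R]_(n, m)).

Definition along (T : Type) (h : R -> 'I_N.+1 -> 'cV[R]_n -> 'cV[R]_n -> T)
    (r : R -> Omega -> 'I_N.+1) (x : R -> Omega -> 'cV[R]_n) (v : R) (w : Omega) : T :=
  h v (r v w) (x v w) (x (v - rho0 v) w).

Definition is_solution (r : R -> Omega -> 'I_N.+1) (s : R) (xi : Crho rho n)
    (x : R -> Omega -> 'cV[R]_n) : Prop :=
  [/\ forall w (tau : `[- rho, 0]%classic), x (s + val tau) w = xi tau,
      forall w, {within `[s - rho, +oo[%classic, continuous (x ^~ w)},
      forall t, s <= t -> meas_wrt (F t) (x t),
      forall t, s <= t -> {ae P, forall w, forall i,
        lebesgue_measure.-integrable `[s, t]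
          (fun v => (along f r x v w i 0)%:E)} &
      forall t, s <= t -> exists2 I, is_ito_integral W s t (along g r x) I &
        {ae P, forall w, x t w = x s w
          + \col_i (\int[lebesgue_measure]_(v in `[s, t]) along f r x v w i 0)
          + I w}].

End switching_sde.

End stochastic_basis.

Section coefficients.
Context {R : realType} {n N p q : nat}.

Definition borel_coef
    (h : R -> 'I_N.+1 -> 'cV[R]_n -> 'cV[R]_n -> 'M[R]_(p, q)) : Prop :=
  borel_fun (fun z : R * discrete_topology 'I_N.+1 * 'cV[R]_n * 'cV[R]_n =>
    h z.1.1.1 z.1.1.2 z.1.2 z.2).

Definition lipschitz_coef
    (h : R -> 'I_N.+1 -> 'cV[R]_n -> 'cV[R]_n -> 'M[R]_(p, q)) : Prop :=
  exists2 L : R, 0 < L & forall t j x1 x2 y1 y2,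
    enorm (h t j x1 x2 - h t j y1 y2) <= L * (enorm (x1 - y1) + enorm (x2 - y2)).

Definition bounded_at0
    (h : R -> 'I_N.+1 -> 'cV[R]_n -> 'cV[R]_n -> 'M[R]_(p, q)) : Prop :=
  forall j, has_ubound [set enorm (h t j 0 0) | t in setT].

End coefficients.

(* The segment x_t; the default value only serves paths that are not continuous
   on [t - rho, t]. *)
Definition segment (R : realType) (rho : R) (n : nat) (x : R -> 'cV[R]_n) (t : R) :
    Crho rho n :=
  match pselect (continuous (fun tau : `[- rho, 0]%classic => x (t + val tau))) with
  | left cx => mkCrho cx
  | right _ => point
  end.

Section markov_process.
Context {d : measure_display} {Omega : measurableType d} {R : realType}.
Variable P : probability Omega R.

Definition state_process {rho : R} {n N : nat}
    (u : R -> R -> Crho rho n -> 'I_N.+1 -> Omega -> 'cV[R]_n)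
    (r : R -> 'I_N.+1 -> R -> Omega -> 'I_N.+1)
    (t s : R) (z : Hsp rho n N) (w : Omega) : Hsp rho n N :=
  (segment rho (fun v => u v s z.1 z.2 w) t, r s z.2 t w).

Context {H : ptopologicalType}.
Variable y : R -> R -> H -> Omega -> H.

Definition trans_prob (t s : R) (z : H) (A : set H) : \bar R :=
  P (y t s z @^-1` A).

Definition trans_op (s t : R) (phi : H -> R) (z : H) : R :=
  \int[P]_w phi (y t s z w).

(* [y] is a time-nonhomogeneous Markov process with transition probabilities
   [trans_prob]: E[phi(y(t,s,z)) | y(v',s,z), s <= v' <= v] =
   P_{v,t} phi (y(v,s,z)) for bounded Borel [phi]. *)
Definition is_markov_process : Prop :=
  (forall t s z, s <= t -> meas_wrt measurable (y t s z)) /\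
  forall s v t z, s <= v -> v <= t ->
    forall phi : H -> R, borel_fun phi -> (exists M : R, forall x, `|phi x| <= M) ->
    forall A, sigma_proc `[s, v]%classic open (fun v' => y v' s z) A ->
    \int[P]_(w in A) phi (y t s z w) =
    \int[P]_(w in A) trans_op v t phi (y v s z w).

Definition is_feller : Prop :=
  forall s t phi, s < t -> Cb phi -> Cb (trans_op s t phi).

Definition periodic_process (varpi : R) : Prop :=
  forall s t z, s <= t -> forall A, <<s @open H >> A ->
    trans_prob (t + varpi) (s + varpi) z A = trans_prob t s z A.

Definition periodic_evolution_system (varpi : R)
    (mu : R -> probability (g_sigma_algebraType (@open H)) R) : Prop :=
  (forall s t phi, s < t -> Cb phi ->
    \int[mu s]_x trans_op s t phi x = \int[mu t]_x phi x) /\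
  forall t A, <<s @open H >> A -> mu (t + varpi) A = mu t A.

End markov_process.

(* Tightness of the sequence [mu k], [k] ranging over [J]. *)
Definition tight {H : ptopologicalType} {R : realType} (J : set nat)
    (mu : nat -> probability (g_sigma_algebraType (@open H)) R) : Prop :=
  forall e : R, 0 < e -> exists2 K : set H, compact K &
    forall k, J k -> ((1 - e)%:E <= mu k K)%E.

(* Main.v *)
(* Krylov-Bogoliubov.  Let L_t f be the limit of the averages \int f dmu_{n,t}
   along one ultrafilter, the same for all t.  By the Chapman-Kolmogorov equation
   \int P_{s,t} f dmu_{n,s} and \int f dmu_{n,t} average the same function
   tau |-> P_{tau,t} f (xi, j) over intervals that differ by a bounded piece, so
   L_s (P_{s,t} f) = L_t f; by periodicity L_{t+varpi} = L_t in the same way.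
   Tightness of mu_{n,t} makes L_t the integral against a probability measure
   (a Daniell-Riesz construction).

   Measurability of tau |-> P(t, tau, xi, j, A) is not assumed.  It can be
   replaced by the fact that the lower integrals of this function and of its
   complement add up, because mu_{n,t} is a probability measure. *)

Require Import Defs.
From HB Require Import structures.
From mathcomp Require Import all_boot all_order all_algebra.
From mathcomp Require Import all_classical all_reals all_analysis.
From mathcomp Require Import measurable_realfun lra.

Set Implicit Arguments.
Unset Strict Implicit.
Unset Printing Implicit Defensive.

Import Order.TTheory GRing.Theory Num.Theory.
Import numFieldNormedType.Exports.

Local Open Scope classical_set_scope.
Local Open Scope ring_scope.

(** * Layer sums *)

Section layers.
Context {R : realType}.
Implicit Types (y : R) (N : nat).

(** For [0 <= y] this is the minimum of [N] and the integer part of [y]. Written as a sum of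
    indicators, it integrates to a sum of measures of superlevel sets. *)
Definition layer_count N y : R := \sum_(i < N) (i.+1%:R <= y)%R%:R.

Lemma layer_count_le N y : 0 <= y -> layer_count N y <= Num.min y N%:R.
Proof.
move=> y0; elim: N => [|N IH]; first by rewrite /layer_count big_ord0 le_min y0 lexx.
rewrite /layer_count big_ord_recr/= -/(layer_count N y) le_min.
move: IH; rewrite le_min => /andP[IH1 IH2].
have SN : (N.+1%:R : R) = N%:R + 1 by rewrite -natr1.
by case: (leP N.+1%:R y) => h /=; rewrite SN in h *; apply/andP; split; lra.
Qed.

Lemma layer_count_ge N y : Num.min y N.+1%:R <= 1 + layer_count N y.
Proof.
elim: N => [|N IH]; first by rewrite /layer_count big_ord0 addr0 ge_min lexx orbT.
rewrite /layer_count big_ord_recr/= -/(layer_count N y).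
move: IH; rewrite !ge_min.
have SN : (N.+2%:R : R) = N.+1%:R + 1 by rewrite -natr1.
case: (leP N.+1%:R y) => h /orP[] IH; rewrite SN; apply/orP => /=; lra.
Qed.

Lemma layer_count_bounds N y : 0 <= y <= 1 -> (0 < N)%N ->
  N%:R^-1 * layer_count N (N%:R * y) <= y <=
  N%:R^-1 + N%:R^-1 * layer_count N (N%:R * y).
Proof.
move=> /andP[y0 y1] N0; have NR : 0 < N%:R :> R by rewrite ltr0n.
have := layer_count_le N (mulr_ge0 (ltW NR) y0).
have := layer_count_ge N (N%:R * y).
have Ny : N%:R * y <= N%:R by rewrite ger_pMr.
have SN : (N.+1%:R : R) = N%:R + 1 by rewrite -natr1.
rewrite le_min ge_min => /orP h1 /andP[h2 _].
have -> : N%:R^-1 + N%:R^-1 * layer_count N (N%:R * y) =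
  N%:R^-1 * (1 + layer_count N (N%:R * y)) by rewrite mulrDr mulr1.
rewrite ler_pdivrMl// h2/= ler_pdivlMl//.
by case: h1 => //; lra.
Qed.

Definition clip01 y : R := Num.min 1 (Num.max 0 y).

Lemma clip01_itv y : 0 <= clip01 y <= 1.
Proof. by rewrite /clip01 le_min ler01 le_max lexx/= ge_min lexx. Qed.

(** Continuous counterpart of [layer_count]: the [i]-th term is 1 as soon as [i.+1%:R <= y], so it
    dominates the [i]-th indicator, yet for [y <= N%:R] the terms add up to exactly [y]. *)
Lemma sum_clip01 N y : 0 <= y -> \sum_(i < N) clip01 (y - i%:R) = Num.min y N%:R.
Proof.
move=> y0; elim: N => [|N IH]; first by rewrite big_ord0 min_r.
rewrite big_ord_recr/= IH /clip01 -natr1.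
have N0 : 0 <= N%:R :> R by [].
case: (leP y N%:R) => h.
  by rewrite (@max_l _ _ 0) ?subr_le0// min_r ?ler01// min_l ?addr0//; lra.
rewrite max_r; last lra.
by case: (leP y (N%:R + 1)) => h'; [rewrite min_r|rewrite min_l]; lra.
Qed.

Context d (T : measurableType d) (P : probability T R).

Lemma integrable_bounded (f : T -> R) (M : R) : measurable_fun setT f ->
  (forall x, `|f x| <= M) -> P.-integrable setT (EFin \o f).
Proof.
move=> mf fM; apply: measurable_bounded_integrable => //.
  by apply: le_lt_trans (probability_le1 P measurableT) _; rewrite ltry.
exists M; split; rewrite ?num_real// => z Mz x _ /=.
exact: le_trans (fM x) (ltW Mz).
Qed.

Lemma integrable_itv01 (f : T -> R) : measurable_fun setT f ->
  (forall x, 0 <= f x <= 1) -> P.-integrable setT (EFin \o f).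
Proof.
move=> mf f01; apply: (@integrable_bounded _ 1) => // x.
by have /andP[? ?] := f01 x; rewrite ger0_norm.
Qed.

Lemma Rintegral_sum I (s : seq I) (f : I -> T -> R) :
  (forall i, P.-integrable setT (EFin \o f i)) ->
  \int[P]_x (\sum_(i <- s) f i x) = \sum_(i <- s) \int[P]_x f i x.
Proof.
move=> fi; elim: s => [|a s IH].
  by under eq_Rintegral do rewrite big_nil; rewrite big_nil Rintegral_cst// mul0r.
under eq_Rintegral do rewrite big_cons.
rewrite big_cons RintegralD// ?IH//.
have := integrable_sum measurableT s (P := xpredT) (fun i _ => fi i).
by apply: eq_integrable => // x _ /=; rewrite sumEFin.
Qed.

Lemma Rintegral_itv01 (f : T -> R) : measurable_fun setT f ->
  (forall x, 0 <= f x <= 1) -> 0 <= \int[P]_x f x <= 1.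
Proof.
move=> mf f01; apply/andP; split.
  by apply: Rintegral_ge0 => x _; have /andP[] := f01 x.
have : \int[P]_x (1 : R) = 1 by rewrite Rintegral_cst//= probability_setT mulr1.
move=> <-; apply: le_Rintegral => //; first exact: integrable_itv01.
  exact: finite_measure_integrable_cst.
by move=> x _; have /andP[] := f01 x.
Qed.

Lemma Rintegral_indic (A : set T) : measurable A ->
  \int[P]_x \1_A x = fine (P A).
Proof. by move=> mA; rewrite /Rintegral integral_indic// setIT. Qed.

Lemma measurable_layer (f : T -> R) (c : R) :
  measurable_fun setT f -> measurable [set x | c <= f x].
Proof.
move=> mf; rewrite -[X in measurable X]setTI.
rewrite (_ : [set x | _] = f @^-1` `[c, +oo[); last first.
  by apply/seteqP; split => x /=; rewrite in_itv/= andbT.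
exact: mf.
Qed.

Definition layer_mass N (f : T -> R) : R :=
  N%:R^-1 * \sum_(i < N) fine (P [set x | i.+1%:R <= N%:R * f x]).

(** Integrated form of [layer_count_bounds]. It reduces claims on integrals to finitely many values
    of the measure on superlevel sets, at the cost of an error [N%:R^-1]. *)
Lemma layer_integral (f : T -> R) N : measurable_fun setT f ->
  (forall x, 0 <= f x <= 1) -> (0 < N)%N ->
  layer_mass N f <= \int[P]_x f x <= N%:R^-1 + layer_mass N f.
Proof.
move=> mf f01 N0; rewrite /layer_mass; set S := \sum_(_ < _) _.
have mNf : measurable_fun setT (fun x => N%:R * f x) 
  by exact: measurable_funM.
have int_ind i : P.-integrable setT
    (EFin \o (fun x => (i.+1%:R <= N%:R * f x)%R%:R : R)).
  have := integrable_indic P (measurable_layer i.+1%:R mNf).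
  apply: eq_integrable => // x _ /=; rewrite indicE; congr (_%:R%:E).
  by rewrite mem_setE.
have SE : S = \int[P]_x layer_count N (N%:R * f x).
  rewrite /layer_count Rintegral_sum//; apply: eq_bigr => i _.
  rewrite -Rintegral_indic; last exact: measurable_layer.
  by apply: eq_Rintegral => x _; rewrite indicE mem_setE.
have int_count : P.-integrable setT (EFin \o (fun x => layer_count N (N%:R * f x))).
  have := integrable_sum measurableT (index_enum 'I_N) (P := xpredT)
    (fun i _ => int_ind (val i)).
  by apply: eq_integrable => // x _ /=; rewrite sumEFin.
have int_Ncount : P.-integrable setT
    (EFin \o (fun x => N%:R^-1 * layer_count N (N%:R * f x))).
  have := integrableZl measurableT N%:R^-1 int_count.
  by apply: eq_integrable => // x _ /=; rewrite EFinM.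
have intf := integrable_itv01 mf f01.
rewrite SE -RintegralZl//; apply/andP; split.
  by apply: le_Rintegral => // x _; have /andP[] := layer_count_bounds (f01 x) N0.
have int_cst := finite_measure_integrable_cst P (N%:R^-1 : R) measurableT.
have <- : \int[P]_x (N%:R^-1 + N%:R^-1 * layer_count N (N%:R * f x)) =
    N%:R^-1 + \int[P]_x (N%:R^-1 * layer_count N (N%:R * f x)).
  rewrite RintegralD//; congr (_ + _).
  by rewrite Rintegral_cst//= probability_setT mulr1.
apply: le_Rintegral => //.
  have := integrableD measurableT int_cst int_Ncount.
  by apply: eq_integrable => // x _ /=; rewrite EFinD.
by move=> x _; have /andP[] := layer_count_bounds (f01 x) N0.
Qed.

End layers.

(** * Representation of tight means *)

Section bounded_continuous.
Context {R : realType} {H : topologicalType}.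
Implicit Types f g : H -> R.

Lemma Cb_cst (c : R) : Cb (fun _ : H => c).
Proof. by split; [move=> x; exact: cvg_cst|exists `|c|]. Qed.

Lemma CbD f g : Cb f -> Cb g -> Cb (fun x => f x + g x).
Proof.
move=> [cf [M fM]] [cg [M' gM]]; split.
  by move=> x; apply: cvgD; [exact: cf|exact: cg].
by exists (M + M') => x; rewrite (le_trans (ler_normD _ _))// lerD.
Qed.

Lemma CbM f g : Cb f -> Cb g -> Cb (fun x => f x * g x).
Proof.
move=> [cf [M fM]] [cg [M' gM]]; split.
  by move=> x; apply: cvgM; [exact: cf|exact: cg].
by exists (M * M') => x; rewrite normrM ler_pM.
Qed.

Lemma CbZ (c : R) f : Cb f -> Cb (fun x => c * f x).
Proof. exact: CbM (Cb_cst c). Qed.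

Lemma CbB f g : Cb f -> Cb g -> Cb (fun x => f x - g x).
Proof.
move=> Cf Cg; have := CbD Cf (CbZ (-1) Cg).
by congr Cb; apply/funext => x; rewrite mulN1r.
Qed.

Lemma Cb_sum I (s : seq I) (f : I -> H -> R) :
  (forall i, Cb (f i)) -> Cb (fun x => \sum_(i <- s) f i x).
Proof.
move=> Cf; elim: s => [|a s IH].
  by have := Cb_cst 0; congr Cb; apply/funext => x; rewrite big_nil.
have := CbD (Cf a) IH.
by congr Cb; apply/funext => x; rewrite big_cons.
Qed.

Lemma Cb_clip01 f : continuous f -> Cb (fun x => clip01 (f x)).
Proof.
move=> cf; split.
  move=> x; apply: (@continuous_min R H (fun=> 1) (fun x => Num.max 0 (f x))).
    exact: cvg_cst.
  by apply: (@continuous_max R H (fun=> 0) f); [exact: cvg_cst|exact: cf].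
by exists 1 => x; have /andP[? ?] := clip01_itv (f x); rewrite ger0_norm.
Qed.

Lemma Cb_rescale f : Cb f -> exists c g, [/\ Cb g, forall x, 0 <= g x <= 1 &
  f = (fun x => (2 * c) * g x - c)].
Proof.
move=> Cf; have [_ [M fM]] := Cf.
(* The summand 1 keeps [c] positive even if the bound [M] is 0, so that one may divide by
   [2 * c]. *)
pose c := `|M| + 1; have c0 : 0 < c by rewrite ltr_wpDl.
have fc x : `|f x| <= c.
  by rewrite (le_trans (fM x))// (le_trans (ler_norm M))// lerDl.
exists c, (fun x => (2 * c)^-1 * (f x + c)); split.
- by apply: CbZ; apply: CbD => //; exact: Cb_cst.
- move=> x; have := fc x; rewrite ler_norml => /andP[h1 h2].
  rewrite mulr_ge0 ?invr_ge0 ?mulr_ge0//= ?(ltW c0)//; last lra.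
  by rewrite ler_pdivrMl ?mulr_gt0//; lra.
- by apply/funext => x; rewrite mulrA divff ?mul1r ?addrK// gt_eqF// mulr_gt0.
Qed.

End bounded_continuous.

(** * Borel measurability of continuous functions *)

Section borel_sigma_algebra.
Context {R : realType} {H : ptopologicalType}.
Local Notation HB := (g_sigma_algebraType (@open H)).

Lemma borel_measurable_fun d (T : measurableType d) (f : T -> HB) :
  meas_wrt measurable f -> measurable_fun setT f.
Proof.
move=> mf; apply: (@measurability _ _ T HB setT f (@open H) erefl) => _ [B oB <-].
by rewrite setTI; exact: mf.
Qed.

Lemma borel_fun_measurable (f : H -> R) :
  borel_fun f -> measurable_fun setT (f : HB -> R).
Proof.
move=> bf; apply: (measurability _ (RGenOpens.measurableE R)).
by move=> _ [_ [a [b ->]] <-]; rewrite setTI; apply: bf; exact: interval_open.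
Qed.

Lemma continuous_borel_fun (f : H -> R) : continuous f -> borel_fun f.
Proof.
move=> cf B oB; apply: sub_sigma_algebra; move: B oB; exact/continuousP.
Qed.

Lemma Cb_measurable (f : H -> R) : Cb f -> measurable_fun setT (f : HB -> R).
Proof.
by move=> [cf _]; apply: borel_fun_measurable; exact: continuous_borel_fun.
Qed.

End borel_sigma_algebra.

(* A mean on [C_b(H)] that is tight in the form in which tightness survives
   weak limits: up to [e], only the values on a compact set matter. *)
Definition tight_mean (R : realType) (H : topologicalType)
    (L : (H -> R) -> R) : Prop :=
  [/\ forall f g, Cb f -> Cb g -> L (fun x => f x + g x) = L f + L g,
      forall c f, Cb f -> L (fun x => c * f x) = c * L f,
      forall f g, Cb f -> Cb g -> (forall x, f x <= g x) -> L f <= L g,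
      L (fun=> 1) = 1 &
      forall e : R, 0 < e -> exists2 K : set H, compact K &
        forall f g, Cb f -> Cb g -> (forall x, f x <= 1) ->
          (forall x, 0 <= g x) -> (forall x, K x -> f x <= g x) ->
          L f <= L g + e].

(** Every clause of [tight_mean] tests the functional on [Cb] only, so its values elsewhere may be
    changed freely. *)
Lemma eq_tight_mean (R : realType) (H : topologicalType)
    (L L' : (H -> R) -> R) :
  (forall f, Cb f -> L f = L' f) -> tight_mean L -> tight_mean L'.
Proof.
move=> LL' [LD LZ Lle L1 Lt]; split.
- by move=> f g Cf Cg; rewrite -!LL'//; [exact: LD|exact: CbD].
- by move=> c f Cf; rewrite -!LL'//; [exact: LZ|exact: CbZ].
- by move=> f g Cf Cg; rewrite -!LL'//; exact: Lle.
- by rewrite -LL'//; exact: Cb_cst.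
- move=> e /Lt[K cK KP]; exists K => // f g Cf Cg; rewrite -!LL'//; exact: KP.
Qed.

Lemma tight_mean_affine (R : realType) (H : topologicalType) (L : (H -> R) -> R)
    (a b : R) (f : H -> R) : tight_mean L -> Cb f ->
  L (fun x => a * f x - b) = a * L f - b.
Proof.
move=> [LD LZ _ L1 _] Cf; rewrite -LZ// -[in RHS](mulr1 b) -mulNr -L1 -LZ//.
  rewrite -LD//; [|exact: CbZ|exact/CbZ/Cb_cst].
  by congr L; apply/funext => x; rewrite mulr1.
exact: Cb_cst.
Qed.

(** With [a = b = -1] this is the reflection of [f] into [1 - f], which later turns one-sided
    inequalities into equalities. *)
Lemma affine_integral d (T : measurableType d) (R : realType)
    (P : probability T R) (a b : R) (f : T -> R) : measurable_fun setT f ->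
  (forall x, 0 <= f x <= 1) ->
  \int[P]_x (a * f x - b) = a * (\int[P]_x f x) - b.
Proof.
move=> mf f01; have fi := integrable_itv01 P mf f01.
rewrite RintegralB//; last 2 first.
- have := integrableZl measurableT a fi.
  by apply: eq_integrable => // x _ /=; rewrite EFinM.
- exact: finite_measure_integrable_cst.
by rewrite RintegralZl// Rintegral_cst//= probability_setT mulr1.
Qed.

(** Every open set is a cozero set: Vedenissoff's form of perfect normality. *)
Definition perfectly_normal (R : realType) (H : topologicalType) : Prop :=
  forall G : set H, open G -> exists2 h : H -> R, continuous h &
    G = [set x | 0 < h x].

(** * The Daniell outer measure of a tight mean and its restriction to Borel sets *)

Section representation.
Context {R : realType} {H : ptopologicalType}.
Local Notation HB := (g_sigma_algebraType (@open H)).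
Hypothesis open_pos : perfectly_normal R H.
Variable L : (H -> R) -> R.
Hypothesis mL : tight_mean L.

Let LD f g : Cb f -> Cb g -> L (fun x => f x + g x) = L f + L g.
Proof. by case: mL => + _ _ _ _; apply. Qed.

Let LZ c f : Cb f -> L (fun x => c * f x) = c * L f.
Proof. by case: mL => _ + _ _ _; apply. Qed.

Let Lle f g : Cb f -> Cb g -> (forall x, f x <= g x) -> L f <= L g.
Proof. by case: mL => _ _ + _ _; apply. Qed.

Let L1 : L (fun=> 1) = 1.
Proof. by case: mL. Qed.

Let LB f g : Cb f -> Cb g -> L (fun x => f x - g x) = L f - L g.
Proof.
move=> Cf Cg; rewrite -mulN1r -LZ// -LD//; last exact: CbZ.
by congr L; apply/funext => x; rewrite mulN1r.
Qed.

Let Lcst c : L (fun=> c) = c.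
Proof.
have := LZ c (@Cb_cst R H 1); rewrite L1 mulr1 => {2}<-.
by congr L; apply/funext => x; rewrite mulr1.
Qed.

Let Lsum I (s : seq I) (f : I -> H -> R) :
  (forall i, Cb (f i)) -> L (fun x => \sum_(i <- s) f i x) = \sum_(i <- s) L (f i).
Proof.
move=> Cf; elim: s => [|a s IH].
  rewrite big_nil -[RHS](Lcst 0).
  by congr L; apply/funext => x; rewrite big_nil.
rewrite big_cons -IH -LD//; last exact: Cb_sum.
by congr L; apply/funext => x; rewrite big_cons.
Qed.

(* Increasing sequences, rather than series, make countable subadditivity a
   matter of adding up the first [k] of them. *)
Definition fun_cover (phi : nat -> H -> R) (A : set H) (c : R) : Prop :=
  [/\ forall k, Cb (phi k), forall k x, 0 <= phi k x,
      forall x, nondecreasing_seq (phi ^~ x),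
      forall k, L (phi k) <= c &
      forall x, A x -> exists k, 1 <= phi k x].

Definition cover_bound (A : set H) (c : R) : Prop := exists phi, fun_cover phi A c.

(** The Daniell upper integral of the indicator of [A], computed from monotone sequences in [Cb]. *)
Definition mean_outer (A : set H) : \bar R :=
  ereal_inf [set c%:E | c in cover_bound A].

Lemma cover_bound_ge0 A c : cover_bound A c -> 0 <= c.
Proof.
move=> [phi [Cphi phi0 _ phic _]]; apply: le_trans (phic 0%N).
by rewrite -(Lcst 0); apply: Lle => //; exact: Cb_cst.
Qed.

Lemma mean_outer_le A c : cover_bound A c -> (mean_outer A <= c%:E)%E.
Proof. by move=> Ac; apply: ereal_inf_lbound; exists c. Qed.

Lemma mean_outer_ge0 A : (0 <= mean_outer A)%E.
Proof.
by apply: le_ereal_inf_tmp => _ [c /cover_bound_ge0 c0 <-]; rewrite lee_fin.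
Qed.

Lemma mean_outer_le1 A : (mean_outer A <= 1)%E.
Proof.
apply: mean_outer_le; exists (fun _ _ => 1); split => //.
- by move=> _; exact: Cb_cst.
- by move=> x k l _.
- by move=> _; rewrite L1.
- by move=> x _; exists 0%N.
Qed.

Lemma mean_outer_fin A : mean_outer A \is a fin_num.
Proof.
rewrite ge0_fin_numE ?mean_outer_ge0//.
by apply: le_lt_trans (mean_outer_le1 A) _; rewrite ltry.
Qed.

Lemma mean_outer_adherent A (e : R) : 0 < e ->
  exists2 c, cover_bound A c & (c%:E <= mean_outer A + e%:E)%E.
Proof.
move=> e0; have [_ [c Ac <-] ce] := lb_ereal_inf_adherent e0 (mean_outer_fin A).
by exists c => //; exact: ltW.
Qed.

Lemma mean_outer0 : mean_outer set0 = 0%E.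
Proof.
apply/eqP; rewrite eq_le mean_outer_ge0 andbT; apply: mean_outer_le.
exists (fun _ _ => 0); split => //.
- by move=> _; exact: Cb_cst.
- by move=> x k l _.
- by move=> _; rewrite Lcst.
Qed.

Lemma le_mean_outer : {homo mean_outer : A B / A `<=` B >-> (A <= B)%E}.
Proof.
move=> A B AB; apply: le_ereal_inf_tmp => _ [c [phi [? ? ? ? phiB]] <-].
by apply: mean_outer_le; exists phi; split => // x /AB; exact: phiB.
Qed.

Lemma mean_outer_sigma_subadditive : sigma_subadditive mean_outer.
Proof.
move=> A; apply/lee_addgt0Pr => e e0.
apply: le_trans (epsilon_trick _ _ (ltW e0)); last first.
  by move=> n; exact: mean_outer_ge0.
have /choice[c cP] n : exists c, cover_bound (A n) c /\
    (c%:E <= mean_outer (A n) + (e / (2 ^ n.+1)%:R)%:E)%E.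
  have [|c] := @mean_outer_adherent (A n) (e / (2 ^ n.+1)%:R); last by exists c.
  by rewrite divr_gt0// ltr0n expn_gt0.
have /choice[phi phiP] n : exists phi, fun_cover phi (A n) (c n) := (cP n).1.
set S := (X in (_ <= X)%E).
have cS k : ((\sum_(0 <= n < k) c n)%:E <= S)%E.
  rewrite -sumEFin; apply: (@le_trans _ _ (\sum_(0 <= n < k)
    (mean_outer (A n) + (e / (2 ^ n.+1)%:R)%:E))%E).
    by apply: lee_sum => n _; exact: (cP n).2.
  apply: nneseries_lim_ge => n _ _; apply: adde_ge0; first exact: mean_outer_ge0.
  by rewrite lee_fin divr_ge0// ltW.
case: (ltP S +oo%E) => [Soo|]; last by rewrite leye_eq => /eqP ->; rewrite leey.
have S0 : (0 <= S)%E by have := cS 0%N; rewrite big_nil.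
have Sfin : S \is a fin_num by rewrite ge0_fin_numE.
rewrite -(fineK Sfin); apply: mean_outer_le.
(* A diagonal choice: the [k]-th function adds the first [k] covers, each at its index [k]. It grows
   with [k] because both the range of the sum and its terms do. *)
exists (fun k x => \sum_(0 <= n < k) phi n k x); split.
- by move=> k; apply: Cb_sum => n; have [] := phiP n.
- by move=> k x; apply: sumr_ge0 => n _; have [] := phiP n.
- move=> x k l kl; rewrite (big_cat_nat _ kl)//=.
  rewrite -[leLHS]addr0 lerD//; last by apply: sumr_ge0 => n _; have [] := phiP n.
  by apply: ler_sum => n _; have [_ _ + _ _] := phiP n; apply.
- move=> k; rewrite Lsum; last by move=> n; have [] := phiP n.
  rewrite -lee_fin fineK//; apply: le_trans (cS k); rewrite lee_fin.
  by apply: ler_sum => n _; have [_ _ _ + _] := phiP n.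
- move=> x [n _ Anx]; have [_ phi0 nd _ /(_ x Anx)[k k1]] := phiP n.
  (* The index has to exceed [n] for the [n]-th cover to occur in the sum, and to reach [k] for that
     cover to be at least 1 at [x]. *)
  exists (maxn k n.+1); apply: (le_trans k1).
  rewrite (@big_cat_nat _ _ _ n.+1)//= ?leq_maxr// big_nat_recr//=.
  apply: (@le_trans _ _ (phi n (maxn k n.+1) x)).
    by apply: nd; exact: leq_maxl.
  rewrite addrAC lerDr addr_ge0//; apply: sumr_ge0 => m _; by have [] := phiP m.
Qed.

HB.instance Definition _ := isOuterMeasure.Build R H mean_outer
  mean_outer0 mean_outer_ge0 le_mean_outer mean_outer_sigma_subadditive.

Let outer : {outer_measure set H -> \bar R} := mean_outer.

(** Continuous functions [psi k] increase to the indicator of [G]. A cover [phi] of [A] then splits: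
    the products [phi k * psi k] cover the part of [A] inside [G], and for a fixed [m] the functions
    [phi k * (1 - psi m)] cover the part outside. Up to [e / 2] the two bounds add up to the bound
    of [phi]. *)
Lemma open_caratheodory G : open G -> caratheodory_measurable mean_outer G.
Proof.
move=> /open_pos[h ch GE].
apply: (@le_caratheodory_measurable R H outer) => A /=.
rewrite -[mean_outer A]adde0; apply/lee_addgt0Pr => e e0; rewrite adde0.
have e20 : 0 < e / 2 by rewrite divr_gt0.
have [c [phi [Cphi phi0 nd phic phiA]] ce] := mean_outer_adherent A e20.
apply: (@le_trans _ _ (c%:E + (e / 2)%:E)%E); last first.
  rewrite {2}[e]splitr EFinD addeA; exact: leeD2r.
pose psi k x := clip01 (k%:R * h x).
have Cpsi k : Cb (psi k).
  by apply: Cb_clip01 => x; apply: cvgM; [exact: cvg_cst|exact: ch].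
have psi01 k x : 0 <= psi k x <= 1 := clip01_itv _.
have psi_nd x : nondecreasing_seq (psi ^~ x).
  move=> k l kl; rewrite /psi /clip01; case: (leP (h x) 0) => hx.
    by rewrite !(@max_l _ _ 0) ?mulr_ge0_le0.
  have klR : k%:R * h x <= l%:R * h x by rewrite ler_wpM2r ?(ltW hx)// ler_nat.
  by rewrite le_min !ge_min !ge_max !le_max !lexx klR !orbT.
have psiG x : G x -> exists k, psi k x = 1.
  rewrite GE /= => hx; have [k kh] := ltr_add_invr hx.
  exists k.+1; rewrite /psi /clip01 min_l// le_max; apply/orP; right.
  by move: kh; rewrite add0r invf_plt ?posrE// => /ltW; rewrite -ler_pdivrMr// div1r.
have psiNG k x : ~ G x -> psi k x = 0.
  rewrite GE /= => /negP; rewrite -leNgt => hx.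
  by rewrite /psi /clip01 max_l ?mulr_ge0_le0// min_r.
pose a k := L (fun x => phi k x * psi k x).
have Cpp k l : Cb (fun x => phi k x * psi l x) by exact: CbM.
have a_le k : a k <= c.
  apply: le_trans (phic k); apply: Lle => // x.
  by have /andP[? ?] := psi01 k x; exact: ler_piMr.
have a_ub : has_sup (range a).
  by split; [exists (a 0%N), 0%N|exists c => _ [k _ <-]].
set s := sup (range a).
have AG : (mean_outer (A `&` G) <= s%:E)%E.
  apply: mean_outer_le; exists (fun k x => phi k x * psi k x); split => //.
  - by move=> k x; rewrite mulr_ge0//; have /andP[] := psi01 k x.
  - move=> x k l kl; apply: ler_pM => //; [by have /andP[] := psi01 k x| |].
      exact: nd.
    exact: psi_nd.
  - by move=> k; apply: ub_le_sup; [exact: a_ub.2|exists k].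
  - move=> x [/phiA[k k1] /psiG[l l1]]; exists (maxn k l).
    have l1' : psi (maxn k l) x = 1.
      have /andP[_ le1] := psi01 (maxn k l) x.
      by apply/le_anti; rewrite le1 -[leLHS]l1 psi_nd// leq_maxr.
    by rewrite l1' mulr1; apply: le_trans k1 _; exact/nd/leq_maxl.
(* [m] brings [a m] within [e / 2] of the supremum [s]. The second cover starts at index [m], so
   that by monotonicity of [phi] the subtracted term never falls below [a m]. *)
have [_ [m _ <-] sm] := sup_adherent e20 a_ub.
have AnG : (mean_outer (A `&` ~` G) <= (c - s + e / 2)%:E)%E.
  apply: mean_outer_le.
  exists (fun k x => phi (k + m)%N x - phi (k + m)%N x * psi m x).
  have E k x : phi k x - phi k x * psi m x = phi k x * (1 - psi m x).
    by rewrite mulrBr mulr1.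
  have psi1 x : 0 <= 1 - psi m x by rewrite subr_ge0; have /andP[] := psi01 m x.
  split.
  - by move=> k; exact: CbB.
  - by move=> k x; rewrite E mulr_ge0.
  - by move=> x k l kl; rewrite !E ler_wpM2r// nd// leq_add2r.
  - move=> k; rewrite LB//.
    have : a m <= L (fun x => phi (k + m)%N x * psi m x).
      apply: Lle => // x; apply: ler_wpM2r; first by have /andP[] := psi01 m x.
      by apply: nd; exact: leq_addl.
    have := phic (k + m)%N; rewrite -/s in sm; lra.
  - move=> x [/phiA[k k1] /(psiNG m) psi0]; exists k.
    rewrite psi0 mulr0 subr0; apply: le_trans k1 _; exact/nd/leq_addr.
apply: (le_trans (leeD AG AnG)).
by rewrite -!EFinD lee_fin; lra.
Qed.

Lemma borel_caratheodory (A : set HB) :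
  measurable A -> caratheodory_measurable mean_outer A.
Proof.
apply: (@smallest_sub _ _ (@open H)
  (@measurable _ (caratheodory_type outer))); last exact: open_caratheodory.
exact: sigma_algebra_measurable.
Qed.

(** Here tightness enters. By a Dini argument a cover of the whole space exceeds [1 - e / 2] on the
    compact set [K] from some index on; tightness then gives [1 - e / 2 <= L (phi k) + e / 2]. *)
Lemma mean_outer_setT : mean_outer setT = 1%E.
Proof.
apply/eqP; rewrite eq_le mean_outer_le1/=; apply: le_ereal_inf_tmp.
move=> _ [c [phi [Cphi phi0 nd phic phiT]] <-]; rewrite lee_fin.
apply/ler_addgt0Pr => e e0; have e20 : 0 < e / 2 by rewrite divr_gt0.
have [_ _ _ _ /(_ _ e20)[K cK KP]] := mL.
(* Dini's theorem through near-coverings: each point has a neighbourhood on which some [phi k]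
   exceeds [1 - e / 2], and monotonicity in the index keeps this true later. *)
have /compact_near_coveringP/(_ _ \oo (fun k x => 1 - e / 2 <= phi k x)) := cK.
case.
  move=> x _; have [k k1] := phiT x I.
  have nx : \near x, 1 - e / 2 < phi k x.
    have [ck _] := Cphi k; apply: (cvgr_gt (phi k x)); first exact: ck.
    by apply: lt_le_trans k1; rewrite ltrBlDr ltrDl.
  exists ([set x | 1 - e / 2 < phi k x], [set l | (k <= l)%N]).
    by split => //=; exists k.
  by move=> [y l] [/= /ltW ky kl]; apply: le_trans ky (nd _ _ _ kl).
move=> k _ /(_ k (leqnn k)) Kk.
have := KP (fun=> 1 - e / 2) (phi k) (Cb_cst _) (Cphi k) _ (phi0 k) Kk.
rewrite Lcst => /(_ (fun=> _)) h; have := phic k.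
have /h : 1 - e / 2 <= 1 by rewrite gerBl ltW.
lra.
Qed.

Lemma mean_outer_probability :
  exists nu : probability HB R, forall A, nu A = mean_outer A.
Proof.
pose m : set HB -> \bar R := mean_outer.
have msa : semi_sigma_additive m.
  move=> F mF tF mUF; apply: (@caratheodory_measure_sigma_additive R H outer) => //.
    by move=> i; exact: borel_caratheodory.
  exact: borel_caratheodory.
pose mm := isMeasure.Build _ HB R m mean_outer0 mean_outer_ge0 msa.
pose nu0 : {measure set HB -> \bar R} := HB.pack m mm.
pose pm := Measure_isProbability.Build _ HB R nu0 mean_outer_setT.
pose nu : probability HB R := HB.pack m mm pm.
by exists nu.
Qed.

Lemma tight_mean_representation : exists nu : probability HB R,
  forall f, Cb f -> \int[nu]_x f x = L f.
Proof.
have [nu nu_outer] := mean_outer_probability; exists nu.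
have nuT : nu setT = 1%E by rewrite nu_outer mean_outer_setT.
have nuE A c : cover_bound A c -> fine (nu A) <= c.
  move=> /mean_outer_le; rewrite -lee_fin nu_outer fineK//; exact: mean_outer_fin.
(* Cut [f] into [N.+1] layers. The superlevel set at height [i.+1] is covered by the [i]-th
   continuous layer, taken as a constant sequence, and these layers add up to [N.+1%:R * f]. *)
have le01 f : Cb f -> (forall x, 0 <= f x <= 1) -> \int[nu]_x f x <= L f.
  move=> Cf f01; apply/ler_addgt0Pr => e e0.
  have [N] := ltr_add_invr e0; rewrite add0r => Ne.
  have NR : 0 < N.+1%:R :> R by [].
  have /andP[_ ] := layer_integral nu (Cb_measurable Cf) f01 (ltn0Sn N).
  move=> /le_trans; apply; rewrite addrC lerD ?(ltW Ne)//.
  rewrite /layer_mass ler_pdivrMl// -LZ//.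
  have Cclip i : Cb (fun x => clip01 (N.+1%:R * f x - i%:R)).
    by apply: Cb_clip01; have [] := CbB (CbZ N.+1%:R Cf) (Cb_cst i%:R).
  rewrite (_ : (fun x => N.+1%:R * f x) =
      (fun x => \sum_(i < N.+1) clip01 (N.+1%:R * f x - i%:R))); last first.
    apply/funext => x; have /andP[f0 f1] := f01 x.
    by rewrite sum_clip01 ?mulr_ge0// min_l// ger_pMr.
  rewrite Lsum//; apply: ler_sum => i _; apply: nuE.
  exists (fun _ x => clip01 (N.+1%:R * f x - i%:R)); split => //.
  - by move=> _ x; have /andP[] := clip01_itv (N.+1%:R * f x - i%:R).
  - by move=> x k l _.
  move=> x /= ix; exists 0%N; rewrite /clip01 le_min lexx le_max.
  by rewrite lerBrDr [1 + _]addrC natr1 ix orbT.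
(* The reverse inequality is [le01] for [1 - f]. *)
have eq01 f : Cb f -> (forall x, 0 <= f x <= 1) -> \int[nu]_x f x = L f.
  move=> Cf f01; apply/eqP; rewrite eq_le le01//=.
  have := le01 (fun x => -1 * f x - -1).
  rewrite (affine_integral nu _ _ (Cb_measurable Cf) f01) tight_mean_affine//.
  rewrite lerD2r !mulN1r lerN2; apply.
    by apply: CbB; [exact: CbZ|exact: Cb_cst].
  by move=> x; have /andP[? ?] := f01 x; apply/andP; split; lra.
move=> f /Cb_rescale[c [g [Cg g01 ->]]].
by rewrite (affine_integral nu _ _ (Cb_measurable Cg) g01) eq01// tight_mean_affine.
Qed.

End representation.

(** * Lower integrals *)

(* The library integral of a nonnegative function that need not be measurable
   is the supremum of the integrals of the simple functions below it, i.e. a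
   lower integral: monotone and superadditive, but not additive. *)
Section lower_integral.
Local Open Scope ereal_scope.
Context d (T : measurableType d) (R : realType) (mu : {measure set T -> \bar R}).
Implicit Types (D E : set T) (f g : T -> \bar R).
Import HBNNSimple.

Lemma lower_integralT_le f y : (forall x, 0 <= f x) ->
  (forall h : T -> R, measurable_fun setT h -> (forall x, (0 <= h x)%R) ->
    (forall x, (h x)%:E <= f x) -> \int[mu]_x (h x)%:E <= y) ->
  \int[mu]_x f x <= y.
Proof.
move=> f0 fy; rewrite ge0_integralTE//; apply: ge_ereal_sup => _ [h hf <-].
by rewrite -integralT_nnsfun; exact: fy.
Qed.

(** The domains may differ, as the comparison of averages over nested intervals requires; enlarging
    the domain is harmless because [g] is nonnegative there. *)
Lemma le_lower_integral D E f g : D `<=` E -> (forall x, E x -> 0 <= g x) ->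
  (forall x, D x -> 0 <= f x) -> (forall x, D x -> f x <= g x) ->
  \int[mu]_(x in D) f x <= \int[mu]_(x in E) g x.
Proof.
move=> DE g0 f0 fg; rewrite !ge0_integralE//; apply: le_ereal_sup => _ [h hf <-].
exists h => // x; apply: le_trans (hf x) _; rewrite !patchE.
case: ifPn => [|_]; first by rewrite inE => Dx; rewrite mem_set ?fg//; exact: DE.
by case: ifPn => //; rewrite inE; exact: g0.
Qed.

(** If [h] and [k] are measurable minorants of [f] and [g], then [h + k] is a minorant of [f + g],
    and the integral is additive on measurable functions. *)
Lemma lower_integral_superD D f g :
  (forall x, D x -> 0 <= f x) -> (forall x, D x -> 0 <= g x) ->
  \int[mu]_(x in D) f x + \int[mu]_(x in D) g x <= \int[mu]_(x in D) (f x + g x).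
Proof.
move=> f0 g0; rewrite !(integral_mkcond D) erestrictD.
have {}f0 : forall x, 0 <= (f \_ D) x by apply: erestrict_ge0.
have {}g0 : forall x, 0 <= (g \_ D) x by apply: erestrict_ge0.
move: (f \_ D) (g \_ D) f0 g0 => {}f {}g f0 g0.
have fg0 x : 0 <= f x + g x by exact: adde_ge0.
(* An infinite right-hand side leaves nothing to prove. Otherwise all integrals involved are finite
   and can be moved across the inequality, so that one minorant is treated at a time. *)
set Z := (X in _ <= X); case: (ltP Z +oo) => [Zoo|]; last first.
  by rewrite leye_eq => /eqP ->; rewrite leey.
have fin h : (forall x, 0 <= h x) -> (forall x, h x <= f x + g x) ->
    \int[mu]_x h x \is a fin_num.
  move=> h0 hfg; rewrite ge0_fin_numE ?integral_ge0//.
  by apply: le_lt_trans Zoo; apply: le_lower_integral.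
have gfin : \int[mu]_x g x \is a fin_num by apply: fin => // x; rewrite leeDr.
rewrite -leeBrDr//; apply: lower_integralT_le => // h mh h0 hf.
have hfin : \int[mu]_x (h x)%:E \is a fin_num.
  apply: fin => [x|x]; first by rewrite lee_fin.
  by apply: le_trans (hf x) _; rewrite leeDl.
rewrite leeBrDr// -leeBrDl//; apply: lower_integralT_le => // k mk k0 kg.
rewrite leeBrDl// -ge0_integralD//.
- by apply: le_lower_integral => // x _; [rewrite adde_ge0 ?lee_fin|exact: leeD].
- by move=> x _; rewrite lee_fin.
- exact/measurable_EFinP.
- by move=> x _; rewrite lee_fin.
- exact/measurable_EFinP.
Qed.

Lemma lower_integral_super_sum D I (s : seq I) (f : I -> T -> \bar R) :
  (forall i x, D x -> 0 <= f i x) ->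
  \sum_(i <- s) \int[mu]_(x in D) f i x <= \int[mu]_(x in D) \sum_(i <- s) f i x.
Proof.
move=> f0; elim: s => [|a s IH].
  by rewrite big_nil; apply: integral_ge0 => x _; rewrite big_nil.
rewrite big_cons; apply: (le_trans (leeD2l _ IH)).
under [leRHS]eq_integral do rewrite big_cons.
apply: lower_integral_superD => [x|x Dx]; first exact: f0.
by apply: sume_ge0 => i _; exact: f0.
Qed.

Lemma lower_integralZl D (c : R) f : (0 < c)%R -> (forall x, D x -> 0 <= f x) ->
  c%:E * \int[mu]_(x in D) f x <= \int[mu]_(x in D) (c%:E * f x).
Proof.
move=> c0 f0; rewrite !(integral_mkcond D) erestrict_scale.
have {}f0 : forall x, 0 <= (f \_ D) x by apply: erestrict_ge0.
move: (f \_ D) f0 => {}f f0.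
rewrite -lee_pdivlMl//; apply: lower_integralT_le => // h mh h0 hf.
rewrite lee_pdivlMl// -ge0_integralZl_EFin//; last 3 first.
- by move=> x _; rewrite lee_fin.
- exact/measurable_EFinP.
- exact: ltW.
apply: le_lower_integral => // x _.
- by rewrite mule_ge0// lee_fin ltW.
- by rewrite -EFinM lee_fin mulr_ge0// ltW.
- by rewrite lee_pmul2l.
Qed.

End lower_integral.

(** * Translation of Lebesgue measure and of lower integrals *)

Section lebesgue_translation.
Local Open Scope ereal_scope.
Context {R : realType}.
Local Notation leb := (@lebesgue_measure R).

Lemma measurable_addr (c : R) :
  measurable_fun setT ((fun x => x + c)%R : measurableTypeR R -> measurableTypeR R).
Proof. by apply: (@measurable_funD _ _ R). Qed.

Lemma preimage_addr_itv (c a b : R) ba bb :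
  (fun x => x + c)%R @^-1` [set` Interval (BSide ba a) (BSide bb b)] =
  [set` Interval (BSide ba (a - c)) (BSide bb (b - c))]%R.
Proof.
by apply/seteqP; split => x; case: ba; case: bb;
  rewrite /= !in_itv/= ?lerBlDr ?ltrBlDr ?lerBrDr ?ltrBrDr.
Qed.

(** Lebesgue measure is determined by its values on half-open intervals, and a translation preserves
    their lengths. *)
Lemma lebesgue_measure_addr (c : R) (A : set R) : measurable A ->
  pushforward leb ((fun x => x + c)%R : measurableTypeR R -> measurableTypeR R) A =
  leb A.
Proof.
have mc := measurable_addr c.
move=> mA; apply/esym/lebesgue_measure_unique => //= _ [[a b]] _ <-.
rewrite /pushforward preimage_addr_itv !lebesgue_measure_itv/=.
by rewrite !lte_fin ltrD2r; case: ifP => // _; rewrite -!EFinB opprB addrA subrK.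
Qed.

(** A measurable minorant of the shifted function, shifted back, is a measurable minorant of [f].
    Invariance of Lebesgue measure is thus applied to measurable functions only. *)
Lemma lower_integral_translate (a b c : R) (f : R -> \bar R) :
  (forall x, 0 <= f x) ->
  \int[leb]_(x in `[a, b]) f (x + c)%R <=
  \int[leb]_(x in `[(a + c)%R, (b + c)%R]) f x.
Proof.
move=> f0; rewrite [leLHS]integral_mkcond.
apply: lower_integralT_le => [x|h mh h0 hf]; first exact: erestrict_ge0.
pose k x := h (x - c)%R; have k0 x : (0 <= k x)%R by exact: h0.
have mk : measurable_fun setT k.
  exact: measurableT_comp mh (measurable_addr (- c)).
have kf x : (k x)%:E <= (f \_ [set` `[(a + c)%R, (b + c)%R]]) x.
  apply: le_trans (hf (x - c)%R) _; rewrite !patchE subrK.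
  have -> : (x \in `[(a + c)%R, (b + c)%R]%classic) =
      ((x - c)%R \in `[a, b]%classic).
    by rewrite !mem_setE !in_itv/= lerBrDr lerBlDr.
  by [].
have -> : \int[leb]_x (h x)%:E = \int[leb]_x (k x)%:E.
  have mc := measurable_addr c.
  rewrite -[RHS](@eq_measure_integral _ _ _ _ leb (pushforward leb
    ((fun x => x + c)%R : measurableTypeR R -> measurableTypeR R))); last first.
    by move=> A mA _; rewrite -[RHS](lebesgue_measure_addr c).
  rewrite ge0_integral_pushforward//=.
  - by apply: eq_integral => x _; rewrite /= /k addrK.
  - exact/measurable_EFinP.
  - by move=> x _; rewrite lee_fin.
rewrite [leRHS]integral_mkcond.
apply: le_lower_integral => // x _; last by rewrite lee_fin.
exact: erestrict_ge0.
Qed.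

End lebesgue_translation.

(** * Time averages *)

Section generalized_limit.
Context {R : realType}.
Implicit Types a b : nat -> R.

Definition bounded_seq a : Prop := exists M : R, forall k, `|a k| <= M.

(** A bounded sequence lives in a compact interval, so it converges along any ultrafilter. One
    ultrafilter finer than [\oo] serves all sequences, which makes the limit linear and monotone
    without extracting subsequences. *)
Lemma generalized_limit : exists Lim : (nat -> R) -> R,
  [/\ forall a b, bounded_seq a -> bounded_seq b ->
        Lim (fun k => a k + b k) = Lim a + Lim b,
      forall c a, bounded_seq a -> Lim (fun k => c * a k) = c * Lim a,
      forall a b, bounded_seq a -> bounded_seq b ->
        (\forall k \near \oo, a k <= b k) -> Lim a <= Lim b &
      forall c, Lim (fun=> c) = c].
Proof.
have [U [UU ooU]] := @ultraFilterLemma nat \oo _.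
have UP : ProperFilter U := @ultra_proper _ _ UU.
have cv a : bounded_seq a -> cvg (a k @[k --> U]).
  move=> [M aM].
  have [|p [_ p_cluster]] := @segment_compact R (- M) M (a k @[k --> U]) _.
    by apply: nearW => k; rewrite /= in_itv/= -ler_norml.
  (* A cluster point is the limit: if the preimage of a neighbourhood [A] of [p] were not in [U],
     its complement would be, and the sequence could not cluster at [p]. *)
  apply/cvg_ex; exists p => A Ap; have [//|UnA] := in_ultra_setVsetC (a @^-1` A) UU.
  by have [x [/= nAx Ax]] := p_cluster (~` A) A UnA Ap.
exists (fun a => lim (a k @[k --> U])); split.
- by move=> a b ba bb; exact: limD (cv _ ba) (cv _ bb).
- by move=> c a ba; exact: (@limZl_tmp _ R^o _ _ _ c a (cv _ ba)).
- move=> a b ba bb ab; apply: (@ler_lim nat U) => //; [exact: cv|exact: cv|].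
  exact: ooU.
- by move=> c; exact: lim_cst.
Qed.

End generalized_limit.

(** * Integrals against averaged transition probabilities *)

Section occupation.
Context {R : realType} d (Omega : measurableType d) (P : probability Omega R).
Context {H : ptopologicalType}.
Local Notation HB := (g_sigma_algebraType (@open H)).
Variable y : R -> R -> H -> Omega -> H.
Hypothesis y_meas : forall t s z, s <= t -> meas_wrt measurable (y t s z).

Lemma measurable_along t s z (f : HB -> R) : s <= t -> measurable_fun setT f ->
  measurable_fun setT (fun w => f (y t s z w)).
Proof.
move=> st mf.
have my : measurable_fun setT (y t s z : Omega -> HB).
  by apply: borel_measurable_fun; exact: y_meas.
exact: measurableT_comp mf my.
Qed.

Lemma trans_op_itv t s z (f : HB -> R) : s <= t -> measurable_fun setT f ->
  (forall x, 0 <= f x <= 1) -> 0 <= trans_op P y s t f z <= 1.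
Proof.
by move=> st mf f01; apply: Rintegral_itv01 => [|w]; first exact: measurable_along.
Qed.

Variables (t a b : R) (z : H).
Hypotheses (ab : a < b) (bt : b <= t).
Variable m : probability HB R.
Hypothesis mE : forall A, <<s @open H >> A ->
  m A = (((b - a)^-1)%R%:E * \int[lebesgue_measure]_(tau in `[a, b]%classic)
    trans_prob P y t tau z A)%E.

Let ba0 : 0 < b - a. Proof. by rewrite subr_gt0. Qed.

(** By layers, the left side is nearly a sum of lower integrals of transition probabilities.
    Superadditivity bounds it by the lower integral of the sum, which lies below [trans_op]; this
    yields one inequality only. *)
Lemma occupation_le (f : HB -> R) : measurable_fun setT f ->
  (forall x, 0 <= f x <= 1) ->
  (((b - a) * \int[m]_x f x)%:E <=
   \int[lebesgue_measure]_(tau in `[a, b]%classic) (trans_op P y tau t f z)%:E)%E.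
Proof.
move=> mf f01; apply/lee_addgt0Pr => e e0.
(* The layer error, multiplied by the length [b - a], has to stay below [e]. *)
have [N] : exists N, N.+1%:R^-1 < e / (b - a).
  have [|N] := @ltr_add_invr _ 0 (e / (b - a)); first by rewrite divr_gt0.
  by rewrite add0r; exists N.
rewrite ltr_pdivlMr// => Ne; have N0 : 0 < N.+1%:R :> R by [].
have st tau : `[a, b]%classic tau -> tau <= t.
  by rewrite /= in_itv/= => /andP[_ /le_trans]; apply.
pose A i := [set x | i.+1%:R <= N.+1%:R * f x].
have mA i : <<s @open H >> (A i).
  by apply: (@measurable_layer R _ HB); exact: measurable_funM.
pose p i tau := trans_prob P y t tau z (A i).
have p0 i tau : (0 <= p i tau)%E by exact: measure_ge0.
have Ip i : (\int[lebesgue_measure]_(tau in `[a, b]%classic) p i tau =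
    (b - a)%:E * m (A i))%E.
  by rewrite mE// muleA -EFinM divff ?mul1e// gt_eqF.
have mass_le : (((b - a) * layer_mass m N.+1 f)%:E <=
    \int[lebesgue_measure]_(tau in `[a, b]%classic) (trans_op P y tau t f z)%:E)%E.
  apply: (@le_trans _ _ (\int[lebesgue_measure]_(tau in `[a, b]%classic)
      (N.+1%:R^-1%:E * \sum_(i < N.+1) p i tau))%E); last first.
    apply: le_lower_integral => //.
    - move=> tau /st tt; rewrite lee_fin.
      by have /andP[] := trans_op_itv z tt mf f01.
    - by move=> tau _; rewrite mule_ge0 ?lee_fin// sume_ge0.
    move=> tau /st tt.
    have /andP[+ _] := layer_integral P (measurable_along z tt mf)
      (fun w => f01 _) (ltn0Sn N).
    rewrite -lee_fin; apply: le_trans; rewrite /layer_mass EFinM -sumEFin.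
    rewrite le_eqVlt; apply/orP; left; apply/eqP; congr (_ * _)%E.
    apply: eq_bigr => i _; rewrite fineK// ge0_fin_numE//.
    apply: le_lt_trans (probability_le1 P _) (ltry _).
    by apply: measurable_layer; apply: measurable_funM => //;
      exact: measurable_along.
  have N'0 : 0 < N.+1%:R^-1 :> R by rewrite invr_gt0.
  have sp0 tau : `[a, b]%classic tau -> (0 <= \sum_(i < N.+1) p i tau)%E.
    by move=> _; exact: sume_ge0.
  apply: le_trans (lower_integralZl lebesgue_measure N'0 sp0).
  have := @lower_integral_super_sum _ _ R lebesgue_measure `[a, b]%classic _
    (index_enum 'I_N.+1) (fun i => p i) (fun i tau _ => p0 i tau).
  have N'E : (0 < N.+1%:R^-1%:E :> \bar R)%E by rewrite lte_fin.
  move=> /(lee_wpmul2l (ltW N'E)); apply: le_trans.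
  rewrite /layer_mass mulrCA EFinM mulr_sumr -sumEFin.
  rewrite (eq_bigr _ (fun i _ => Ip (val i))).
  rewrite le_eqVlt; apply/orP; left; apply/eqP; congr (_ * _)%E.
  apply: eq_bigr => i _; rewrite EFinM fineK// ge0_fin_numE//.
  by apply: le_lt_trans (probability_le1 m _) (ltry _); exact: mA.
apply: le_trans (leeD2r _ mass_le); rewrite -EFinD lee_fin.
have /andP[_ h] := layer_integral m mf f01 (ltn0Sn N).
apply: le_trans (ler_wpM2l (ltW ba0) h) _.
by rewrite mulrDr addrC lerD2l mulrC ltW.
Qed.

(** Apply [occupation_le] to [f] and to [1 - f]. The two lower bounds add up to [b - a], and by
    superadditivity the two lower integrals add up to at most [b - a], so both inequalities are
    equalities. *)
Lemma occupation_integral (f : HB -> R) : measurable_fun setT f ->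
  (forall x, 0 <= f x <= 1) ->
  (\int[lebesgue_measure]_(tau in `[a, b]%classic) (trans_op P y tau t f z)%:E =
   ((b - a) * \int[m]_x f x)%:E)%E.
Proof.
move=> mf f01; apply/eqP; rewrite eq_le occupation_le// andbT.
pose f' x := -1 * f x - -1.
have mf' : measurable_fun setT f'.
  by apply: measurable_funB => //; exact: measurable_funM.
have f'01 x : 0 <= f' x <= 1.
  by have /andP[? ?] := f01 x; rewrite /f'; apply/andP; split; lra.
have st tau : `[a, b]%classic tau -> tau <= t.
  by rewrite /= in_itv/= => /andP[_ /le_trans]; apply.
have := occupation_le mf' f'01.
rewrite (affine_integral m _ _ mf f01).
set I' := (X in (_ <= X)%E).
set I := (\int[lebesgue_measure]_(tau in _) (trans_op P y tau t f z)%:E)%E.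
have : (I + I' <= (b - a)%:E)%E.
  have G0 (h : HB -> R) tau : measurable_fun setT h -> (forall x, 0 <= h x <= 1) ->
      `[a, b]%classic tau -> (0 <= (trans_op P y tau t h z)%:E)%E.
    move=> mh h01 /st tt; rewrite lee_fin.
    by have /andP[] := trans_op_itv z tt mh h01.
  have := lower_integral_superD lebesgue_measure
    (fun tau => G0 f tau mf f01) (fun tau => G0 f' tau mf' f'01).
  move=> /le_trans; apply.
  have -> : (b - a)%:E =
      (\int[lebesgue_measure]_(tau in `[a, b]%classic) cst 1 tau)%E.
    by rewrite integral_cst//= lebesgue_measure_itv/= lte_fin ab mul1e EFinB.
  rewrite le_eqVlt; apply/orP; left; apply/eqP; apply: eq_integral => tau.
  rewrite inE => /st tt; rewrite -EFinD; congr (_%:E).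
  have mfy := measurable_along z tt mf.
  rewrite /trans_op (affine_integral P _ _ mfy) => [|w]; last exact: f01.
  by lra.
have I0 : (0 <= I)%E.
  apply: integral_ge0 => tau /st tt; rewrite lee_fin.
  by have /andP[] := trans_op_itv z tt mf f01.
have I'0 : (0 <= I')%E.
  apply: integral_ge0 => tau /st tt; rewrite lee_fin.
  by have /andP[] := trans_op_itv z tt mf' f'01.
(* Nonnegativity and the bound on [I + I'] exclude infinite values; what remains is real
   arithmetic. *)
move: I I' I0 I'0 => [r| |] [r'| |]//= _ _; rewrite -EFinD !lee_fin.
by rewrite mulrBr mulrN1 mulrCA; lra.
Qed.

End occupation.

Lemma law_integral d (Omega : measurableType d) d' (T : measurableType d')
    (R : realType) (P : probability Omega R) (X Y : Omega -> T) (f : T -> R) :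
  measurable_fun setT X -> measurable_fun setT Y ->
  (forall A, measurable A -> P (X @^-1` A) = P (Y @^-1` A)) ->
  measurable_fun setT f -> (forall x, 0 <= f x) ->
  \int[P]_w f (X w) = \int[P]_w f (Y w).
Proof.
move=> mX mY XY mf f0.
have mfE : measurable_fun setT (EFin \o f) by exact/measurable_EFinP.
have f0E : {in setT, forall x, (0 <= (EFin \o f) x)%E}.
  by move=> x _; rewrite lee_fin.
rewrite /Rintegral; congr fine.
have := ge0_integral_pushforward mX P measurableT mfE f0E.
have := ge0_integral_pushforward mY P measurableT mfE f0E.
rewrite !preimage_setT /= => <- <-.
by apply: eq_measure_integral => A mA _; exact: XY.
Qed.

(** * The Krylov-Bogoliubov argument on an abstract state space *)

Section krylov_bogoliubov.
Context {R : realType} d (Omega : measurableType d) (P : probability Omega R).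
Context {H : ptopologicalType}.
Local Notation HB := (g_sigma_algebraType (@open H)).
Variable y : R -> R -> H -> Omega -> H.
Hypotheses (H_hausdorff : hausdorff_space H) (H_normal : perfectly_normal R H).
Hypotheses (markov : is_markov_process P y) (feller : is_feller P y).
Variables (rho : R) (z : H) (mu : nat -> R -> probability HB R).
Hypothesis rho_ge0 : 0 <= rho.
Hypothesis muE : forall k t, rho - t < k%:R -> forall A, <<s @open H >> A ->
  mu k t A = (((t - rho + k%:R)^-1)%R%:E *
    \int[lebesgue_measure]_(tau in `[(- k%:R)%R, (t - rho)%R]%classic)
      trans_prob P y t tau z A)%E.
Hypothesis mu_tight :
  forall t, tight [set k | rho - t < k%:R] (fun k => mu k t).
Variable varpi : R.
Hypothesis varpi_gt0 : 0 < varpi.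
Hypothesis periodic : periodic_process P y varpi.

Let y_meas t s x : s <= t -> meas_wrt measurable (y t s x).
Proof. exact: markov.1. Qed.

Let occupation k t (f : H -> R) :=
  (\int[lebesgue_measure]_(tau in `[(- k%:R)%R, (t - rho)%R]%classic)
     (trans_op P y tau t f z)%:E)%E.

Let occupationE k t f : rho - t < k%:R -> Cb f -> (forall x, 0 <= f x <= 1) ->
  occupation k t f = ((t - rho + k%:R) * \int[mu k t]_x f x)%:E.
Proof.
move=> kt Cf f01; rewrite -[in RHS](opprK k%:R).
have kt' : - k%:R < t - rho by lra.
have rt : t - rho <= t by rewrite gerBl.
apply: (occupation_integral y_meas kt' rt) => //.
- by move=> A mA; rewrite opprK; exact: muE.
- exact: Cb_measurable.
Qed.

(** Chapman-Kolmogorov: the Markov property integrated over the whole sample space. *)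
Let trans_op_cocycle tau s t f : tau <= s -> s <= t -> Cb f ->
  trans_op P y tau t f z = trans_op P y tau s (trans_op P y s t f) z.
Proof.
move=> ts st [cf bf]; apply: markov.2 => //; first exact: continuous_borel_fun.
rewrite /sigma_proc; set G := (X in <<s X>>).
by have [/[swap]/[apply]] := smallest_sigma_algebra setT G; rewrite setD0.
Qed.

Let trans_op01 s t f : s <= t -> Cb f -> (forall x, 0 <= f x <= 1) ->
  forall x, 0 <= trans_op P y s t f x <= 1.
Proof. by move=> st Cf f01 x; apply: trans_op_itv => //; exact: Cb_measurable. Qed.

(** By the cocycle identity both sides integrate the same nonnegative function of [tau], and the
    interval that belongs to [s] is contained in the one that belongs to [t]. *)
Let average_trans_op k s t f : rho - s < k%:R -> s < t -> Cb f ->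
  (forall x, 0 <= f x <= 1) ->
  (s - rho + k%:R) * (\int[mu k s]_x trans_op P y s t f x) <=
  (t - rho + k%:R) * \int[mu k t]_x f x.
Proof.
move=> ks st Cf f01; have st' := ltW st; have Cg := feller st Cf.
have g01 := trans_op01 st' Cf f01.
have kt : rho - t < k%:R by lra.
rewrite -lee_fin -!occupationE//.
apply: le_lower_integral.
- by move=> tau; rewrite /= !in_itv/= => /andP[-> ?] /=; lra.
- move=> tau; rewrite /= in_itv/= => /andP[_ h]; rewrite lee_fin.
  have tt : tau <= t by rewrite (le_trans h)// gerBl.
  by have /andP[] := trans_op01 tt Cf f01 z.
- move=> tau; rewrite /= in_itv/= => /andP[_ h]; rewrite lee_fin.
  have ts : tau <= s by rewrite (le_trans h)// gerBl.
  by have /andP[] := trans_op01 ts Cg g01 z.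
- move=> tau; rewrite /= in_itv/= => /andP[_ h]; rewrite lee_fin.
  have ts : tau <= s by rewrite (le_trans h)// gerBl.
  by rewrite (trans_op_cocycle ts st' Cf).
Qed.

Let trans_op_periodic tau t f : tau <= t -> Cb f -> (forall x, 0 <= f x <= 1) ->
  trans_op P y (tau + varpi) (t + varpi) f z = trans_op P y tau t f z.
Proof.
move=> tt Cf f01; apply: (@law_integral _ _ _ HB) => //.
- by apply: borel_measurable_fun; apply: y_meas; rewrite lerD2r.
- by apply: borel_measurable_fun; exact: y_meas.
- by move=> A mA; exact: periodic.
- exact: Cb_measurable.
- by move=> x; have /andP[] := f01 x.
Qed.

(** Shifting [tau] by [varpi] moves the interval for [t] into the interval for [t + varpi], and
    periodicity keeps the integrand unchanged. *)
Let average_periodic k t f : rho - t < k%:R -> Cb f ->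
  (forall x, 0 <= f x <= 1) ->
  (t - rho + k%:R) * (\int[mu k t]_x f x) <=
  (t + varpi - rho + k%:R) * \int[mu k (t + varpi)]_x f x.
Proof.
move=> kt Cf f01; have w0 := varpi_gt0.
have kt' : rho - (t + varpi) < k%:R by lra.
rewrite -lee_fin -!occupationE//.
pose F tau := (trans_op P y tau (t + varpi) f z)%:E.
(* The translation lemma asks for nonnegativity at every [tau], also beyond [t + varpi], where
   [trans_op01] does not apply. *)
have F0 tau : (0 <= F tau)%E.
  rewrite lee_fin; apply: Rintegral_ge0 => w _.
  by have /andP[] := f01 (y (t + varpi) tau z w).
have -> : occupation k t f = (\int[lebesgue_measure]_(tau in
    `[(- k%:R)%R, (t - rho)%R]%classic) F (tau + varpi)%R)%E.
  apply: eq_integral => tau; rewrite inE/= in_itv/= => /andP[_ h].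
  have tt : tau <= t by rewrite (le_trans h)// gerBl.
  by rewrite /F trans_op_periodic.
apply: le_trans (lower_integral_translate _ _ _ F0) _.
apply: le_lower_integral => // [tau|tau _]; last exact: F0.
by rewrite /= !in_itv/= => /andP[h1 h2]; apply/andP; split; lra.
Qed.

(** The ratio of the lengths [c + k] and [c' + k] tends to 1, so the first comparison gives
    [Lim a <= Lim b]; the comparison of [1 - a] with [1 - b] gives the converse. *)
Let squeeze_limit (Lim : (nat -> R) -> R) (c c' : R) (a b : nat -> R) :
  (forall u v, bounded_seq u -> bounded_seq v ->
    Lim (fun k => u k + v k) = Lim u + Lim v) ->
  (forall u v, bounded_seq u -> bounded_seq v ->
    (\forall k \near \oo, u k <= v k) -> Lim u <= Lim v) ->
  (forall r, Lim (fun=> r) = r) ->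
  c <= c' -> (forall k, 0 <= a k <= 1) -> (forall k, 0 <= b k <= 1) ->
  (\forall k \near \oo, (c + k%:R) * a k <= (c' + k%:R) * b k) ->
  (\forall k \near \oo, (c + k%:R) * (1 - a k) <= (c' + k%:R) * (1 - b k)) ->
  Lim a = Lim b.
Proof.
move=> LimD Lim_le Limc cc' a01 b01 ab ab'.
have bnd01 u : (forall k, 0 <= u k <= 1) -> bounded_seq u.
  by move=> u01; exists 1 => k; have /andP[? ?] := u01 k; rewrite ger0_norm.
have bnd_e u e : (forall k, 0 <= u k <= 1) -> bounded_seq (fun k => u k + e).
  move=> u01; exists (1 + `|e|) => k; apply: le_trans (ler_normD _ _) _.
  by rewrite lerD2r; have /andP[? ?] := u01 k; rewrite ger0_norm.
have bndc e : bounded_seq (fun=> e : R) by exists `|e|.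
apply/eqP; rewrite eq_le; apply/andP; split; apply/ler_addgt0Pr => e e0.
- rewrite -[in leRHS](Limc e) -LimD//; [|exact: bnd01].
  apply: Lim_le; [exact: bnd01|exact: bnd_e|].
  near=> k; have k0 : 0 < c + k%:R.
    rewrite addrC -ltrBlDr sub0r; near: k; exact: nbhs_infty_gtr.
  (* From this index on the excess length [c' - c] is at most [e * (c + k%:R)]. *)
  have ke : (c' - c) / e - c <= k%:R by near: k; exact: nbhs_infty_ger.
  have abk : (c + k%:R) * a k <= (c' + k%:R) * b k by near: k.
  have /andP[b0 b1] := b01 k.
  have ke' : c' - c <= e * (c + k%:R) by rewrite -ler_pdivrMl// mulrC; lra.
  by rewrite -(ler_pM2l k0); nra.
- rewrite -[in leRHS](Limc e) -LimD//; [|exact: bnd01].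
  apply: Lim_le; [exact: bnd01|exact: bnd_e|].
  near=> k; have k0 : 0 < c + k%:R.
    rewrite addrC -ltrBlDr sub0r; near: k; exact: nbhs_infty_gtr.
  have ke : (c' - c) / e - c <= k%:R by near: k; exact: nbhs_infty_ger.
  have abk : (c + k%:R) * (1 - a k) <= (c' + k%:R) * (1 - b k) by near: k.
  have /andP[b0 b1] := b01 k.
  have ke' : c' - c <= e * (c + k%:R) by rewrite -ler_pdivrMl// mulrC; lra.
  by rewrite -(ler_pM2l k0); nra.
Unshelve. all: by end_near. Qed.

Theorem krylov_bogoliubov_periodic :
  exists nu : R -> probability HB R, periodic_evolution_system P y varpi nu.
Proof.
have [Lim [LimD LimZ Lim_le Limc]] := @generalized_limit R.
(* The same [Lim] for every [t] makes means at different times comparable. It only sees eventual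
   inequalities, so the finitely many [mu k t] with [k%:R <= rho - t] do not matter. *)
pose L t f := Lim (fun k => \int[mu k t]_x f x).
have int_bnd t f : Cb f -> bounded_seq (fun k => \int[mu k t]_x f x).
  move=> Cf; have mf := Cb_measurable Cf; have [_ [M fM]] := Cf; exists M => k.
  have fi := integrable_bounded (mu k t) mf fM.
  apply: le_trans (le_normr_Rintegral measurableT fi) _.
  have : \int[mu k t]_x M = M.
    by rewrite Rintegral_cst//= probability_setT mulr1.
  move=> <-; apply: le_Rintegral => //.
  - exact: integrable_norm.
  - exact: finite_measure_integrable_cst.
have int_ f : Cb f -> forall k t, (mu k t).-integrable setT (EFin \o f).
  move=> Cf k t; have [_ [M fM]] := Cf.
  exact: integrable_bounded (Cb_measurable Cf) fM.
have meanL t : tight_mean (L t).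
  split.
  - move=> f g Cf Cg; rewrite /L -LimD; [|exact: int_bnd|exact: int_bnd].
    by congr Lim; apply/funext => k; rewrite RintegralD//; exact: int_.
  - move=> c f Cf; rewrite /L -LimZ; last exact: int_bnd.
    by congr Lim; apply/funext => k; rewrite RintegralZl//; exact: int_.
  - move=> f g Cf Cg fg; apply: Lim_le; [exact: int_bnd|exact: int_bnd|].
    by apply: nearW => k; apply: le_Rintegral => //; exact: int_.
  - rewrite -[RHS]Limc; congr Lim; apply/funext => k.
    by rewrite Rintegral_cst//= probability_setT mulr1.
  (* The hypotheses on [f] and [g] give [f <= g] plus the indicator of the complement of [K], which
     has mass at most [e] under [mu k t] for large [k]. *)
  move=> e /(mu_tight t)[K cK muK]; exists K => // f g Cf Cg f1 g0 fg.
  have mK : measurable (K : set HB).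
    rewrite -[K]setCK; apply: measurableC; apply: sub_sigma_algebra.
    by apply: closed_openC; exact: compact_closed.
  have mKc : measurable (~` K : set HB) by exact: measurableC.
  have bnd_e : bounded_seq (fun=> e : R) by exists `|e|.
  rewrite -[in leRHS](Limc e) -LimD//; last exact: int_bnd.
  have [M gM] := int_bnd t g Cg.
  apply: Lim_le; first exact: int_bnd.
    by exists (M + `|e|) => k; rewrite (le_trans (ler_normD _ _))// lerD2r.
  near=> k; have kJ : rho - t < k%:R by near: k; exact: nbhs_infty_gtr.
  have KcE : \int[mu k t]_x \1_(~` K) x <= e.
    rewrite Rintegral_indic// probability_setC//.
    have := muK k kJ; have := probability_le1 (mu k t) mK.
    have := measure_ge0 (mu k t) K.
    case: (mu k t K) => [r| |]//= _ _; rewrite lee_fin; lra.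
  have m1 : measurable_fun setT (\1_(~` K) : HB -> R) by exact: measurable_indic.
  have i1 : (mu k t).-integrable setT (EFin \o (\1_(~` K) : HB -> R)).
    apply: integrable_itv01 => // x.
    by rewrite indicE; case: (_ \in _); rewrite lexx ler01.
  apply: le_trans (lerD (lexx _) KcE).
  rewrite -RintegralD//; last exact: int_.
  apply: le_Rintegral => //; first exact: int_.
    have := integrableD measurableT (int_ g Cg k t) i1.
    by apply: eq_integrable => // x _ /=; rewrite EFinD.
  move=> x _; rewrite indicE; case: (boolP (x \in ~` K)) => [_|].
    by rewrite (le_trans (f1 x))// lerDr.
  by rewrite addr0 notin_setE => /contrapT; exact: fg.
(* Two means agree once the unnormalized averages compare in one direction, both for the functions
   and for their reflections. *)
have agree s t (c c' : R) (f g : H -> R) : c <= c' -> Cb f -> Cb g ->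
    (forall x, 0 <= f x <= 1) -> (forall x, 0 <= g x <= 1) ->
    (\forall k \near \oo, (c + k%:R) * (\int[mu k s]_x f x) <=
       (c' + k%:R) * (\int[mu k t]_x g x)) ->
    (\forall k \near \oo, (c + k%:R) * (\int[mu k s]_x (-1 * f x - -1)) <=
       (c' + k%:R) * (\int[mu k t]_x (-1 * g x - -1))) ->
    L s f = L t g.
  move=> cc' Cf Cg f01 g01 h h'.
  have i01 (p : probability HB R) (u : H -> R) : Cb u ->
      (forall x, 0 <= u x <= 1) -> 0 <= \int[p]_x u x <= 1.
    by move=> Cu; exact: (Rintegral_itv01 p (Cb_measurable Cu)).
  apply: (squeeze_limit (c := c) (c' := c')) => // [k|k|]; [exact: i01|exact: i01|].
  apply: filterS h' => k.
  rewrite (affine_integral _ _ _ (Cb_measurable Cf) f01).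
  rewrite (affine_integral _ _ _ (Cb_measurable Cg) g01).
  by rewrite opprK !mulN1r ![- _ + 1]addrC.
have flip (f : H -> R) : Cb f -> (forall x, 0 <= f x <= 1) ->
    Cb (fun x => -1 * f x - -1) /\ forall x, 0 <= -1 * f x - -1 <= 1.
  move=> Cf f01; split; first by apply: CbB; [exact: CbZ|exact: Cb_cst].
  by move=> x; have /andP[? ?] := f01 x; apply/andP; split; lra.
have L_evol s t f : s < t -> Cb f -> L s (trans_op P y s t f) = L t f.
  move=> st /Cb_rescale[c [g [Cg g01 ->]]]; have Cg' := feller st Cg.
  (* Serves twice: to undo the rescaling of the test function, and with [a = b = -1] to commute the
     reflection with [trans_op]. *)
  have transE a b x : trans_op P y s t (fun x => a * g x - b) x =
      a * trans_op P y s t g x - b.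
    have m_along := measurable_along y_meas x (ltW st) (Cb_measurable Cg).
    by rewrite /trans_op (affine_integral P _ _ m_along)// => w; exact: g01.
  rewrite (_ : trans_op _ _ _ _ _ =
    fun x => 2 * c * trans_op P y s t g x - c); last first.
    by apply/funext => x; rewrite transE.
  rewrite !tight_mean_affine//; congr (_ * _ - _).
  have [Cng ng01] := flip g Cg g01.
  apply: (agree _ _ (s - rho) (t - rho)) => //; first by rewrite lerD2r ltW.
  - by apply: trans_op01 => //; exact: ltW.
  - near=> k; apply: average_trans_op => //; near: k; exact: nbhs_infty_gtr.
  - near=> k.
    rewrite (_ : (fun x => -1 * trans_op P y s t g x - -1) =
      trans_op P y s t (fun x => -1 * g x - -1)); last first.
      by apply/funext => x; rewrite transE.
    by apply: average_trans_op => //; near: k; exact: nbhs_infty_gtr.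
have L_per t f : Cb f -> L (t + varpi) f = L t f.
  move=> /Cb_rescale[c [g [Cg g01 ->]]].
  rewrite !tight_mean_affine//; congr (_ * _ - _); apply/esym.
  have [Cng ng01] := flip g Cg g01.
  apply: (agree _ _ (t - rho) (t + varpi - rho)) => //.
  - by rewrite lerD2r lerDl ltW.
  - near=> k; apply: average_periodic => //; near: k; exact: nbhs_infty_gtr.
  - near=> k; apply: average_periodic => //; near: k; exact: nbhs_infty_gtr.
(* The measure is chosen as a function of the mean restricted to [C_b(H)], so
   that equal means give equal measures. *)
pose Lb t f := if pselect (Cb f) then L t f else 0.
have LbE t f : Cb f -> Lb t f = L t f by rewrite /Lb; case: pselect.
have meanLb t : tight_mean (Lb t).
  by apply: eq_tight_mean (meanL t) => f Cf; rewrite LbE.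
have /choice[N NP] (M : (H -> R) -> R) : exists nu : probability HB R,
    tight_mean M -> forall f, Cb f -> \int[nu]_x f x = M f.
  have [tM|ntM] := pselect (tight_mean M).
    by have [nu nuM] := tight_mean_representation H_normal tM; exists nu.
  (* A default for functionals that are not tight means; any probability measure would do. *)
  by exists (mu 0%N 0).
exists (fun t => N (Lb t)); split.
  move=> s t f st Cf; have Cg := feller st Cf.
  by rewrite !NP// !LbE// L_evol.
move=> t A _; suff -> : Lb (t + varpi) = Lb t by [].
apply/funext => f; rewrite /Lb; case: (pselect (Cb f)) => // Cf.
exact: L_per.
Unshelve. all: by end_near. Qed.

End krylov_bogoliubov.

(** * Metric spaces, and the switching system itself *)

Lemma metric_perfectly_normal (R : realType) (T : metricType R) :
  perfectly_normal R T.
Proof.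
(* If the complement of [G] is empty, the infimum used below would take the default value 0, so a
   positive constant replaces it. *)
move=> G oG; have [GT|/set0P G0] := eqVneq (~` G) set0.
  exists (fun=> 1); first by move=> x; exact: cvg_cst.
  by rewrite -[G]setCK GT setC0; apply/seteqP; split => // x _; exact: ltr01.
(* [inf (D x)] is the distance from [x] to the complement of [G]: it is 1-Lipschitz, vanishes off
   [G], and is positive on [G] because a ball around [x] fits into [G]. *)
pose D x := [set mdist x a | a in ~` G].
have D_lb x : has_inf (D x).
  split; first by have [a Ga] := G0; exists (mdist x a), a.
  by exists 0 => _ [a _ <-]; exact: mdist_ge0.
have D_le x a : ~ G a -> inf (D x) <= mdist x a.
  by move=> Ga; apply: ge_inf; [exact: (D_lb x).2|exists a].
have D_lip x x' : inf (D x) <= inf (D x') + mdist x x'.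
  rewrite -lerBlDr; apply: lb_le_inf; first exact: (D_lb x').1.
  move=> _ [a Ga <-]; rewrite lerBlDr addrC.
  exact: le_trans (D_le _ _ Ga) (metric_triangle x x' a).
exists (fun x => inf (D x)).
  move=> x; apply/cvgrPdist_lt => e e0; near=> x'.
  have : ball x e x' by near: x'; exact: nbhsx_ballx.
  rewrite ballEmdist /= => xe; have := D_lip x x'; have := D_lip x' x.
  by rewrite (metric_sym x' x) ltr_norml; move: xe; lra.
apply/seteqP; split => x /=.
  move=> Gx; have /nbhs_ballP[e /= e0 eG] : nbhs x G by exact: open_nbhs_nbhs.
  apply: lt_le_trans e0 _; apply: lb_le_inf; first exact: (D_lb x).1.
  move=> _ [a Ga <-]; rewrite leNgt; apply/negP => ae; apply: Ga; apply: eG.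
  by rewrite ballEmdist.
move=> h; apply: contrapT => /(D_le x); rewrite mdistxx => h'.
by move: (lt_le_trans h h'); rewrite ltxx.
Unshelve. all: by end_near. Qed.

(** The state space carries a metric, so it is Hausdorff and perfectly normal, and the abstract
    theorem applies to [state_process u r] started from [(xi, j)]. *)
Theorem lemma2p4
  (R : realType) (d : measure_display) (Omega : measurableType d)
  (P : probability Omega R) (F : R -> set (set Omega))
  (n m N : nat) (rho : R) (rho0 : R -> R)
  (W : R -> Omega -> 'cV[R]_m) (Gam : 'M[R]_N.+1)
  (r : R -> 'I_N.+1 -> R -> Omega -> 'I_N.+1)
  (f : R -> 'I_N.+1 -> 'cV[R]_n -> 'cV[R]_n -> 'cV[R]_n)
  (g : R -> 'I_N.+1 -> 'cV[R]_n -> 'cV[R]_n -> 'M[R]_(n, m))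
  (u : R -> R -> Crho rho n -> 'I_N.+1 -> Omega -> 'cV[R]_n)
  (rho_range : 0 < rho <= 1)
  (basis : usual_conditions P F)
  (wiener : is_wiener P F W)
  (generator : is_generator Gam)
  (chain : forall s j, is_markov_chain P F W Gam s j (r s j))
  (rho_ge0range : forall t, 0 <= rho0 t <= rho)
  (rho_ge0borel : measurable_fun setT rho0)
  (f_borel : borel_coef f) (g_borel : borel_coef g)
  (A0_f : lipschitz_coef f) (A0_g : lipschitz_coef g)
  (A1_f : bounded_at0 f) (A1_g : bounded_at0 g)
  (* u(., s, xi, j) is the solution, and y(t, s, xi, j) = (u_t, r_{s,j}(t)) is a
     Markov process with the Feller property *)
  (solution : forall s xi j,
     is_solution P F W rho0 f g (r s j) s xi (fun t => u t s xi j))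
  (markov : is_markov_process P (state_process u r))
  (feller : is_feller P (state_process u r))
  (xi : Crho rho n) (j : 'I_N.+1)
  (mu : nat -> R -> probability (HspB rho n N) R)
  (muE : forall k t, rho - t < k%:R -> forall A, <<s @open (Hsp rho n N) >> A ->
     mu k t A = (((t - rho + k%:R)^-1)%R%:E *
       \int[lebesgue_measure]_(tau in `[(- k%:R)%R, (t - rho)%R]%classic)
         trans_prob P (state_process u r) t tau (xi, j) A)%E)
  (varpi : R) (varpi_gt0 : 0 < varpi)
  (mu_tight : forall t, tight [set k | rho - t < k%:R] (fun k => mu k t))
  (periodic : periodic_process P (state_process u r) varpi) :
  exists nu : R -> probability (HspB rho n N) R,
    periodic_evolution_system P (state_process u r) varpi nu.
Proof.
have rho_ge0 : 0 <= rho by case/andP: rho_range => /ltW.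
apply: krylov_bogoliubov_periodic rho_ge0 muE mu_tight _ varpi_gt0 periodic => //.
- exact: metric_hausdorff.
- exact: metric_perfectly_normal.
Qed.
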